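(* Let $\mathsf k$ be an infinite field (of arbitrary characteristic), $S=\mathsf k[x,y,z]$, and let $R=S/I$ be a standard graded Artinian Gorenstein $\mathsf k$-algebra of codimension three. If the number of peaks of the $h$-vector of $R$ satisfies $\mathrm{NS}_R\ge 3$, then $R$ has the weak Lefschetz property.
   Context: $S=\mathsf k[x,y,z]$ has the standard grading, $\mathfrak m=\langle x,y,z\rangle$, and $I\subseteq\mathfrak m$ is a homogeneous ideal; $M_i$ denotes the degree $i$ component of a graded object $M$. $R=S/I$ is Artinian if $\dim_{\mathsf k}R<\infty$; its socle degree is the largest $d$ with $R_d\ne 0$, and its $h$-vector is $(h_0,\dots,h_d)$ with $h_i=\dim_{\mathsf k}R_i$. The codimension of $R$ is $h_1$ (so codimension three means $I\subseteq\mathfrak m^2$). $R$ is Gorenstein if its socle $\operatorname{soc}(R)=\{a\in R\mid \mathfrak m a=0\}$ has $\mathsf k$-dimension $1$. Let $S_R=\max_i h_i$, $t=\min\{i\mid h_i=S_R\}$, $s=\max\{i\mid h_i=S_R\}$. The number of peaks is $\mathrm{NS}_R=s-t+1$ (since the $h$-vector of such an $R$ is known to be unimodal, this is the number of degrees in which the $h$-vector attains its maximum). $R$ has the weak Lefschetz property if there is a linear form $\ell\in R_1$ such that for every $i\ge 0$ the multiplication map $\times\ell\colon R_i\to R_{i+1}$ is injective or surjective. *)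

(* Defs.v *)
From HB Require Import structures.
From mathcomp Require Import all_boot all_order all_algebra.
From mathcomp Require Import mpoly.
Set Implicit Arguments.
Unset Strict Implicit.
Unset Printing Implicit Defensive.
Import GRing.Theory.
Local Open Scope ring_scope.
Local Open Scope quotient_scope.

Definition infinite_field (k : fieldType) : Prop :=
  forall s : seq k, exists x, x \notin s.

(* [A] is meant to be a linear subspace of [V]; the dimension is a relation so
   that no decidability of [A] or finiteness of [V] is needed. *)
Section Dimension.
Variables (k : fieldType) (V : lmodType k).

Definition lin_indep n (b : 'I_n -> V) : Prop :=
  forall c : 'I_n -> k, \sum_i c i *: b i = 0 -> forall i, c i = 0.

Definition spans n (b : 'I_n -> V) (A : V -> Prop) : Prop :=
  forall v, A v -> exists c : 'I_n -> k, v = \sum_i c i *: b i.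

Definition has_dim (A : V -> Prop) n : Prop :=
  exists b : 'I_n -> V, [/\ forall i, A (b i), lin_indep b & spans b A].

End Dimension.

(* MathComp quotient rings carry no module structure over the coefficients of
   the polynomial ring; [pi_scale] shows this is the action induced by
   scalar multiplication of polynomials. *)
Section QuotientModule.
Variables (k : fieldType) (n : nat) (I : idealr {mpoly k[n]}).
Local Notation R := {ideal_quot I}.

Definition quot_scale (c : k) (a : R) : R := \pi_R (c%:MP_[n]) * a.

Lemma quot_scaleA c d a : quot_scale c (quot_scale d a) = quot_scale (c * d) a.
Proof. by rewrite /quot_scale mulrA -rmorphM /= mpolyCM. Qed.

Lemma quot_scale1 : left_id 1 quot_scale.
Proof. by move=> a; rewrite /quot_scale mpolyC1 rmorph1 mul1r. Qed.

Lemma quot_scaleDr : right_distributive quot_scale +%R.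
Proof. by move=> c a b; rewrite /quot_scale mulrDr. Qed.

Lemma quot_scaleDl a : {morph quot_scale^~ a : c d / c + d}.
Proof. by move=> c d; rewrite /quot_scale mpolyCD rmorphD mulrDl. Qed.

HB.instance Definition _ := GRing.Zmodule_isLmodule.Build k R
  quot_scaleA quot_scale1 quot_scaleDr quot_scaleDl.

Lemma pi_scale c (f : {mpoly k[n]}) : \pi_R (c *: f) = c *: \pi_R f.
Proof. by rewrite -mul_mpolyC rmorphM. Qed.

End QuotientModule.

Section GradedQuotient.
Variables (k : fieldType) (n : nat) (I : idealr {mpoly k[n]}).
Local Notation R := {ideal_quot I}.

Definition homogeneous_ideal : Prop :=
  forall f, f \in I -> forall d, pihomog mdeg d f \in I.

Definition max_ideal (f : {mpoly k[n]}) : Prop :=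
  exists g : 'I_n -> {mpoly k[n]}, f = \sum_i g i * 'X_i.

Definition graded_part (d : nat) (a : R) : Prop :=
  exists2 f : {mpoly k[n]}, f \is d.-homog & a = \pi_R f.

Definition artinian : Prop := exists m, has_dim (fun _ : R => True) m.

Definition socle (a : R) : Prop := forall f, max_ideal f -> \pi_R f * a = 0.

Definition gorenstein : Prop := has_dim socle 1.

Definition socle_degree (d : nat) : Prop :=
  (exists2 a, graded_part d a & a <> 0) /\
  (forall i a, (d < i)%N -> graded_part i a -> a = 0).

Definition is_hvector (h : seq nat) : Prop :=
  exists d, [/\ socle_degree d, size h = d.+1 &
    forall i, (i <= d)%N -> has_dim (graded_part i) (nth 0%N h i)].

Definition weak_lefschetz : Prop :=
  exists2 l, graded_part 1 l & forall i,
    (forall a b, graded_part i a -> graded_part i b -> l * a = l * b -> a = b)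
    \/ (forall b, graded_part i.+1 b -> exists2 a, graded_part i a & l * a = b).

End GradedQuotient.

Section Peaks.
Variable h : seq nat.

Definition hmax : nat := \max_(x <- h) x.
Definition first_peak : nat := index hmax h.
Definition last_peak : nat := \max_(i < size h | nth 0%N h i == hmax) i.
Definition num_peaks : nat := (last_peak - first_peak + 1)%N.

End Peaks.

(* Main.v *)
Require Import Defs.
From HB Require Import structures.
From mathcomp Require Import all_boot all_order all_algebra.
From mathcomp Require Import mpoly ssrcomplements.
From mathcomp Require Import ring zify.
Set Implicit Arguments.
Unset Strict Implicit.
Unset Printing Implicit Defensive.
Import GRing.Theory.
Local Open Scope ring_scope.
Local Open Scope quotient_scope.

(** Write S = k[x,y,z]. Macaulay duality turns the algebra R = S/I of socle
    degree d into a linear functional phi on the forms of degree d: a form g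
    of degree i <= d lies in I exactly when phi(gh) = 0 for all forms h of
    degree d - i ([dual_functional], [pairing]). So h_i is the rank of the
    catalecticant matrix of phi in degrees (i, d - i) ([dim_rank]), and
    transposing that matrix gives h_i = h_(d-i).

    Fix a point Q = (a : b : 1) and let l be the generic line through Q, with
    slope an indeterminate s, over K = k(s). Restricting forms to this line
    sends I_i to polynomials of degree at most i in one variable Z; let J_i be
    the K-span of the image and c_i = i + 1 - dim J_i, which is the dimension
    of R/lR in degree i. Thus c_i = h_i - r_i, where r_i is the rank of
    multiplication by l from R_(i-1) to R_i. This r_i is also a catalecticant
    rank, for the contracted functional g |-> phi(l g) on degree d - 1, so
    r_i = r_(d+1-i), and therefore
        h_i - h_(i-1) = c_i - c_(d+1-i).
    Because J_(i+1) contains both J_i and Z J_i, the sequence c_i does not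
    increase from the first degree in which J_i is nonzero; hence the
    h-vector does not decrease up to the middle ([catal_unimodal]). This
    elementary proof of unimodality works over every field.

    Now let h_i = h_(i+1) with 2i + 2 <= d. Then c is constant from degree
    i + 1 to degree d - i.
    - If the constant is 0, multiplication by l maps R_i onto R_(i+1), and so
      does some line with slope in the infinite field k ([specialize_rank]).
    - Otherwise dim J_(i+2) = dim J_(i+1) + 1 while J_(i+1) is a proper
      subspace of the polynomials of degree at most i + 1. A space of
      polynomials growing so slowly consists of multiples of one nonconstant
      polynomial ([window_gcd]), provided that it contains a polynomial of
      full degree; this holds when Q is chosen outside the zero locus of some
      form in I_(i+1) ([good_point]). By Gauss's lemma and homogenization all
      of I_(i+1) is divisible by one form F of degree f > 0 ([gauss_factor],
      [dehomog_factor]). Counting multiples of F then shows that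
      h_(i+1) - h_i is at least f plus the growth of the Hilbert function of
      the contraction of phi by F, which is nonnegative by unimodality
      ([factor_growth]): a contradiction.

    Three peaks provide such a degree: if t is the first peak, symmetry puts
    the last one in degree d - t, so 2t + 2 <= d, and unimodality makes t + 1
    a peak too. Once a linear form is bijective from R_t to R_(t+1), it is
    injective below, since R has no socle in degrees less than d, and
    surjective above, since R is generated in degree one
    ([lefschetz_of_plateau]). *)

(** * Forms as coordinate vectors, and catalecticant matrices *)

Definition mons i : seq 'X_{1..3} :=
  [seq s2m t | t : i.-tuple 'I_3 <- enum (basis 3 i)].

Definition nmons i := size (mons i).

Definition mon i (p : 'I_(nmons i)) : 'X_{1..3} := nth 0%MM (mons i) p.

Lemma nmonsE i : nmons i = 'C(i.+2, 2).
Proof. by rewrite /nmons size_basis addn2 -(@bin_sub _ 2) // !subSS subn0. Qed.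

Lemma nmons_succ i : nmons i.+1 = (nmons i + i.+2)%N.
Proof. by rewrite !nmonsE binS bin1 addnC. Qed.

Lemma nmons0 : nmons 0 = 1%N.
Proof. by rewrite nmonsE. Qed.

Lemma mdeg_mon i (p : 'I_(nmons i)) : mdeg (mon p) = i.
Proof. by apply/eqP; rewrite basis_cover mem_nth. Qed.

Lemma mon_inj i : injective (@mon i).
Proof.
move=> p q /eqP; rewrite /mon nth_uniq ?uniq_basis //.
by move/eqP/val_inj.
Qed.

Lemma monP (m : 'X_{1..3}) : exists p : 'I_(nmons (mdeg m)), m = mon p.
Proof.
have: m \in mons (mdeg m) by rewrite -basis_cover.
move=> mi; have lt : (index m (mons (mdeg m)) < nmons (mdeg m))%N by rewrite index_mem.
by exists (Ordinal lt); rewrite /mon nth_index.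
Qed.

Section Forms.
Variable F : fieldType.
Implicit Types (g h : {mpoly F[3]}).

Definition form_of i (u : 'rV[F]_(nmons i)) : {mpoly F[3]} :=
  \sum_p u 0 p *: 'X_[mon p].

Definition coords i g : 'rV[F]_(nmons i) := \row_p g@_(mon p).

Lemma form_of_homog i u : @form_of i u \is i.-homog.
Proof.
by apply: rpred_sum => p _; apply: rpredZ; rewrite dhomogX; apply/eqP/mdeg_mon.
Qed.

Lemma form_ofK i : cancel (@form_of i) (@coords i).
Proof.
move=> u; apply/rowP=> p; rewrite mxE linear_sum /= (bigD1 p) //=.
rewrite mcoeffZ mcoeffX eqxx mulr1 big1 ?addr0 // => q nqp.
by rewrite mcoeffZ mcoeffX (inj_eq (@mon_inj i)) (negbTE nqp) mulr0.
Qed.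

Lemma coordsK i g : g \is i.-homog -> form_of (coords i g) = g.
Proof.
move=> hg; apply/mpolyP=> m; have [dm|ndm] := eqVneq (mdeg m) i; last first.
  by rewrite !(dhomog_nemf_coeff _ ndm) ?form_of_homog.
have [p ->] : exists p : 'I_(nmons i), m = mon p by rewrite -dm; exact: monP.
by move/rowP: (form_ofK (coords i g)) => /(_ p); rewrite !mxE.
Qed.

Lemma form_of_is_linear i : linear (@form_of i).
Proof.
move=> c u v; rewrite /form_of scaler_sumr -big_split; apply: eq_bigr => p _ /=.
by rewrite !mxE scalerDl scalerA.
Qed.
HB.instance Definition _ i := GRing.isLinear.Build F _ _ _ (@form_of i)
  (@form_of_is_linear i).

Lemma coords_is_linear i : linear (@coords i).
Proof. by move=> c u v; apply/rowP=> p; rewrite !mxE mcoeffD mcoeffZ. Qed.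
HB.instance Definition _ i := GRing.isLinear.Build F _ _ _ (@coords i)
  (@coords_is_linear i).

Variable mu : 'X_{1..3} -> F.

(** A functional is given by its values mu on monomials, of all degrees at
    once: only the values in one degree matter for a given matrix, and a family
    of scalars is transported along field extensions by plain composition. *)
Definition ev g : F := \sum_(m <- msupp g) g@_m * mu m.

Lemma evwE k g : (msize g <= k)%N ->
  ev g = \sum_(m : 'X_{1..3 < k}) g@_m * mu m.
Proof.
move=> lt_pk; pose I : subFinType _ := 'X_{1..3 < k}.
rewrite /ev (big_mksub I) //=; first last.
+ by move=> x /msize_mdeg_lt /leq_trans /(_ lt_pk) ->.
+ by rewrite msupp_uniq.
by rewrite big_rmcond //= => m /memN_msupp_eq0 ->; rewrite mul0r.
Qed.

Lemma ev_is_linear : linear_for *%R ev.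
Proof.
move=> c g h; pose k := maxn (msize (c *: g + h)) (maxn (msize g) (msize h)).
rewrite !(@evwE k) ?leq_max ?leqnn ?orbT //.
rewrite mulr_sumr -big_split; apply: eq_bigr => m _ /=.
by rewrite mcoeffD mcoeffZ mulrDl mulrA.
Qed.
HB.instance Definition _ := GRing.isLinear.Build F _ _ _ ev ev_is_linear.

Lemma evX m : ev 'X_[m] = mu m.
Proof. by rewrite /ev msuppX big_seq1 mcoeffX eqxx mul1r. Qed.

(** The catalecticant matrix: the pairing of forms of degrees i and e that the
    functional induces through the product. *)
Definition catal i e : 'M[F]_(nmons i, nmons e) :=
  \matrix_(p, q) mu (mon p + mon q).

Lemma mul_catalE i e (u : 'rV_(nmons i)) q :
  (u *m catal i e) 0 q = ev (form_of u * 'X_[mon q]).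
Proof.
rewrite mxE /form_of mulr_suml linear_sum; apply: eq_bigr => p _ /=.
by rewrite mxE -scalerAl linearZ /= -mpolyXD evX.
Qed.

Lemma catal_kerP i e (u : 'rV_(nmons i)) :
  (u *m catal i e == 0) <-> forall h, h \is e.-homog -> ev (form_of u * h) = 0.
Proof.
split=> [/eqP u0 h hh|u0]; last first.
  apply/eqP/rowP=> q; rewrite mul_catalE mxE u0 //.
  by rewrite dhomogX; apply/eqP/mdeg_mon.
rewrite -(coordsK hh) [form_of (coords _ _)]/form_of mulr_sumr linear_sum big1 // => q _ /=.
by rewrite -scalerAr linearZ /= -mul_catalE u0 [X in _ * X]mxE mulr0.
Qed.

Lemma trmx_catal i e : (catal i e)^T = catal e i.
Proof. by apply/matrixP=> p q; rewrite !mxE addmC. Qed.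

Lemma rank_catalC i e : \rank (catal i e) = \rank (catal e i).
Proof. by rewrite -trmx_catal mxrank_tr. Qed.

End Forms.

Section Contraction.
Variable F : fieldType.
Implicit Types (g h G : {mpoly F[3]}) (mu : 'X_{1..3} -> F).

(** The action of forms on functionals in Macaulay duality: the functional
    g |-> mu(G g). *)
Definition contract mu G : 'X_{1..3} -> F := fun m => ev mu (G * 'X_[m]).

Lemma ev_contract mu G g : ev (contract mu G) g = ev mu (G * g).
Proof.
rewrite {2}(mpolyE g) mulr_sumr linear_sum /=.
by apply: eq_bigr => m _; rewrite -scalerAr linearZ.
Qed.

Definition mulform G i j : 'M[F]_(nmons i, nmons j) :=
  \matrix_p coords j (G * 'X_[mon p]).

Lemma mul_mulform G i j (u : 'rV_(nmons i)) :
  u *m mulform G i j = coords j (G * form_of u).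
Proof.
rewrite mulmx_sum_row /form_of mulr_sumr linear_sum; apply: eq_bigr => p _ /=.
by rewrite -scalerAr linearZ /= rowK.
Qed.

Variables (G : {mpoly F[3]}) (f i j : nat).
Hypotheses (hG : G \is f.-homog) (dj : j = (f + i)%N).

Lemma form_mulform (u : 'rV_(nmons i)) :
  form_of (u *m mulform G i j) = G * form_of u.
Proof. by rewrite mul_mulform coordsK // dj dhomogM // form_of_homog. Qed.

(** Multiplication by G on one side of the pairing is contraction of the
    functional. The right-hand side is again a catalecticant matrix, hence
    symmetric in its degrees; this symmetry is what controls the rank of a
    multiplication map. *)
Lemma mulform_catal mu e : mulform G i j *m catal mu j e = catal (contract mu G) i e.
Proof.
apply/row_matrixP=> p; rewrite !rowE mulmxA; apply/rowP=> q.
rewrite !mul_catalE form_mulform -mulrA -ev_contract; congr (ev _ (_ * _)).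
Qed.

Lemma mulform_free : G != 0 -> row_free (mulform G i j).
Proof.
move=> nzG; rewrite -kermx_eq0; apply/eqP/row_matrixP=> p.
rewrite row0; have: row p (kermx (mulform G i j)) *m mulform G i j = 0.
  by apply/sub_kermxP; rewrite row_sub.
move/(congr1 (@form_of _ _)); rewrite form_mulform linear0 => /eqP.
rewrite mulf_eq0 (negbTE nzG) /= => /eqP u0.
by rewrite -[LHS]form_ofK u0 linear0.
Qed.

End Contraction.

Section BaseChange.
Variables (k K : fieldType) (iota : {rmorphism k -> K}).

Lemma map_catal (mu : 'X_{1..3} -> k) i e :
  map_mx iota (catal mu i e) = catal (iota \o mu) i e.
Proof. by apply/matrixP=> p q; rewrite !mxE. Qed.

Lemma ev_map (mu : 'X_{1..3} -> k) g :
  ev (iota \o mu) (map_mpoly iota g) = iota (ev mu g).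
Proof.
rewrite {1}(mpolyE g) (raddf_sum (map_mpoly iota)) linear_sum.
rewrite [in RHS]/ev [RHS]raddf_sum; apply: eq_bigr => m _ /=.
by rewrite map_mpolyZ map_mpolyX linearZ /= evX /= rmorphM.
Qed.

Lemma map_form_of i (u : 'rV[k]_(nmons i)) :
  map_mpoly iota (form_of u) = form_of (map_mx iota u).
Proof.
rewrite /form_of raddf_sum; apply: eq_bigr => p _ /=.
by rewrite map_mpolyZ map_mpolyX mxE.
Qed.

End BaseChange.

(** * Substitution into homogeneous polynomials *)
Section MmapLemmas.
Variables (F : fieldType) (A B : comNzRingType).
Implicit Types (f : {rmorphism F -> A}) (h : 'I_3 -> A).

Lemma rmorph_mmap (Phi : {rmorphism A -> B}) f h (g : {mpoly F[3]}) :
  Phi (mmap f h g) = mmap (Phi \o f) (Phi \o h) g.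
Proof.
rewrite /mmap rmorph_sum; apply: eq_bigr => m _ /=.
rewrite rmorphM /mmap1 rmorph_prod; congr (_ * _).
by apply: eq_bigr => i _; rewrite rmorphXn.
Qed.

Lemma eq_mmap f1 f2 h1 h2 (g : {mpoly F[3]}) :
  f1 =1 f2 -> h1 =1 h2 -> mmap f1 h1 g = mmap f2 h2 g.
Proof.
move=> ef eh; apply: eq_bigr => m _; rewrite ef; congr (_ * _).
by apply: mmap1_eq.
Qed.

Lemma mmap_scale f h c i (g : {mpoly F[3]}) : g \is i.-homog ->
  mmap f (fun j => c * h j) g = c ^+ i * mmap f h g.
Proof.
move=> hg; rewrite /mmap mulr_sumr; apply: eq_big_seq => m mg /=.
rewrite mulrCA; congr (_ * _); rewrite /mmap1.
rewrite (eq_bigr (fun j => c ^+ m j * h j ^+ m j)); last first.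
  by move=> j _; rewrite exprMn.
rewrite big_split /= -expr_sum -mdegE; congr (_ ^+ _ * _).
exact: (dhomog_mf hg).
Qed.

Lemma mmap_map_mpoly (K : fieldType) (iota : {rmorphism F -> K})
    (f : {rmorphism K -> A}) h g :
  mmap f h (map_mpoly iota g) = mmap (f \o iota) h g.
Proof.
rewrite [in LHS](mpolyE g) (raddf_sum (map_mpoly iota)) /= raddf_sum.
apply: eq_bigr => m _ /=.
by rewrite map_mpolyZ map_mpolyX mmapZ mmapX.
Qed.

End MmapLemmas.

Section TopCoef.
Variable A : comNzRingType.

Lemma coefM_top (p q : {poly A}) a b :
  (size p <= a.+1)%N -> (size q <= b.+1)%N -> (p * q)`_(a + b) = p`_a * q`_b.
Proof.
move=> sp sq; rewrite coefM.
have lt_a : (a < (a + b).+1)%N by rewrite ltnS leq_addr.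
rewrite (bigD1 (Ordinal lt_a)) //= addKn big1 ?addr0 // => j nj.
have {}nj : (j : nat) != a by apply: contraNneq nj => ja; apply/eqP/val_inj.
case: (ltngtP j a) nj => // ja _; last first.
  by rewrite [p`_j]nth_default ?mul0r // (leq_trans sp).
rewrite [q`_ _]nth_default ?mulr0 // (leq_trans sq) //.
by rewrite ltn_subRL -addnS; move: ja; lia.
Qed.

Lemma size_mul_leqS (p q : {poly A}) a b :
  (size p <= a.+1)%N -> (size q <= b.+1)%N -> (size (p * q)%R <= (a + b).+1)%N.
Proof. by move=> sp sq; apply: leq_trans (size_polyMleq _ _) _; lia. Qed.

Lemma exp_top (p : {poly A}) n : (size p <= 2)%N ->
  (size (p ^+ n)%R <= n.+1)%N /\ (p ^+ n)`_n = p`_1 ^+ n.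
Proof.
move=> sp; elim: n => [|n [IHs IHc]]; first by rewrite !expr0 size_poly1 coef1.
rewrite !exprS; split; first exact: (@size_mul_leqS _ _ 1).
by rewrite -[X in _`_X]add1n coefM_top ?IHc.
Qed.

Lemma mmap1_top (h : 'I_3 -> {poly A}) (m : 'X_{1..3}) :
  (forall i, (size (h i) <= 2)%N) ->
  (size (mmap1 h m) <= (mdeg m).+1)%N /\
  (mmap1 h m)`_(mdeg m) = mmap1 (fun i => (h i)`_1) m.
Proof.
move=> sh; rewrite /mmap1 mdegE.
elim/big_rec3: _ => [|i a p n _ [sp <-]]; first by rewrite size_poly1 coef1.
have [si <-] := exp_top (m i) (sh i).
by split; [exact: size_mul_leqS | rewrite coefM_top].
Qed.

Lemma mmap_top (F : fieldType) (f : {rmorphism F -> A}) (h : 'I_3 -> {poly A})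
    i (g : {mpoly F[3]}) :
  (forall i, (size (h i) <= 2)%N) -> g \is i.-homog ->
  (size (mmap (polyC \o f) h g) <= i.+1)%N /\
  (mmap (polyC \o f) h g)`_i = mmap f (fun j => (h j)`_1) g.
Proof.
move=> sh hg; rewrite /mmap; split.
  rewrite big_seq; apply: leq_trans (size_sum _ _ _) _.
  apply/bigmax_leqP_seq => m mg _ /=.
  rewrite mul_polyC (leq_trans (size_scale_leq _ _)) //.
  by have [+ _] := mmap1_top m sh; rewrite (dhomog_mf hg mg).
rewrite coef_sum; apply: eq_big_seq => m mg /=.
rewrite coefCM; congr (_ * _).
by have [_ <-] := mmap1_top m sh; rewrite (dhomog_mf hg mg).
Qed.

Lemma size_rmorph_mmap (B : comNzRingType) (F : fieldType)
    (Phi : {rmorphism B -> {poly A}}) (f : {rmorphism F -> B})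
    (f2 : {rmorphism F -> A}) (h : 'I_3 -> B) i (g : {mpoly F[3]}) :
  (forall c, Phi (f c) = (f2 c)%:P) -> (forall j, (size (Phi (h j)) <= 2)%N) ->
  g \is i.-homog -> (size (Phi (mmap f h g)) <= i.+1)%N.
Proof.
move=> ff2 sh hg; rewrite rmorph_mmap.
rewrite (@eq_mmap _ _ _ (polyC \o f2) _ (Phi \o h)) //.
exact: (mmap_top f2 sh hg).1.
Qed.

End TopCoef.

(** * Restriction to a line, and dehomogenization *)
Notation ix := (ord0 : 'I_3).
Notation iy := (lift ord0 ord0 : 'I_3).
Notation iz := (lift ord0 (lift ord0 ord0) : 'I_3).

Lemma ord3P (P : 'I_3 -> Prop) : P ix -> P iy -> P iz -> forall i, P i.
Proof.
move=> P0 P1 P2 [[|[|[|//]]] lt].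
- by have -> : Ordinal lt = ix by apply: val_inj.
- by have -> : Ordinal lt = iy by apply: val_inj.
- by have -> : Ordinal lt = iz by apply: val_inj.
Qed.

Section Line.
Variables (F : fieldType) (A : comNzRingType) (iota : {rmorphism F -> A}).
Variables (s al be : A).

(** The line x - al z = s (y - be z) passes through the point (al : be : 1).
    In the chart y - be z = 1, with Z the value of z, its points are
    (s + al Z, 1 + be Z, Z); the point (al : be : 1) is at infinity. *)
Definition line_pt (i : 'I_3) : {poly A} :=
  nth 0 [:: s%:P + al *: 'X; 1 + be *: 'X; 'X] i.

Definition to_line : {mpoly F[3]} -> {poly A} := mmap (polyC \o iota) line_pt.
HB.instance Definition _ := GRing.RMorphism.copy to_line (mmap (polyC \o iota) line_pt).

Lemma to_lineC c : to_line c%:MP = (iota c)%:P.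
Proof. by rewrite /to_line mmapC. Qed.

Lemma to_lineZ c g : to_line (c *: g) = iota c *: to_line g.
Proof. by rewrite -mul_mpolyC rmorphM /= to_lineC mul_polyC. Qed.

Lemma to_lineX i : to_line 'X_i = line_pt i.
Proof. by rewrite /to_line mmapX mmap1U. Qed.

Lemma size_line_pt i : (size (line_pt i) <= 2)%N.
Proof.
elim/ord3P: i => /=; last by rewrite size_polyX.
- rewrite (leq_trans (size_polyD _ _)) // geq_max.
  rewrite (leq_trans (size_polyC_leq1 _)) //=.
  by rewrite (leq_trans (size_scale_leq _ _)) ?size_polyX.
- rewrite (leq_trans (size_polyD _ _)) // geq_max size_poly1.
  by rewrite (leq_trans (size_scale_leq _ _)) ?size_polyX.
Qed.

Lemma size_to_line i g : g \is i.-homog -> (size (to_line g) <= i.+1)%N.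
Proof. by move=> hg; have [] := mmap_top iota size_line_pt hg. Qed.

(** The coefficient of Z^i is the value of g at the point at infinity
    (al : be : 1) of the line. *)
Lemma to_line_top i g : g \is i.-homog ->
  (to_line g)`_i = mmap iota (fun j => nth 0 [:: al; be; 1] j) g.
Proof.
move=> hg; have [_ ->] := mmap_top iota size_line_pt hg.
apply: eq_mmap => // j; elim/ord3P: j => /=.
- by rewrite coefD coefC coefZ coefX mulr1 add0r.
- by rewrite coefD coef1 coefZ coefX mulr1 add0r.
- by rewrite coefX.
Qed.

End Line.

Lemma map_to_line (F : fieldType) (A B : comNzRingType) (iota : {rmorphism F -> A})
    (f : {rmorphism A -> B}) s al be g :
  map_poly f (to_line iota s al be g) = to_line (f \o iota) (f s) (f al) (f be) g.
Proof.
rewrite /to_line rmorph_mmap; apply: eq_mmap => [c|i] /=; first exact: map_polyC.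
elim/ord3P: i => /=.
- by rewrite rmorphD /= map_polyC map_polyZ map_polyX.
- by rewrite rmorphD rmorph1 /= map_polyZ map_polyX.
- by rewrite map_polyX.
Qed.

Lemma to_line_map (F K : fieldType) (A : comNzRingType) (iota : {rmorphism F -> K})
    (f : {rmorphism K -> A}) s al be g :
  to_line f s al be (map_mpoly iota g) = to_line (f \o iota) s al be g.
Proof. by rewrite /to_line mmap_map_mpoly; apply: eq_mmap. Qed.

(** Evaluation is used only through its values on constants and on the two
    variables, so it is kept abstract. *)
Lemma eval2_exists (k : fieldType) (B : comNzRingType) (f : {rmorphism k -> B})
    (x y : B) : {psi : {rmorphism {poly {poly k}} -> B} |
  [/\ psi 'X = y, psi 'X%:P = x & forall c : k, psi c%:P%:P = f c]}.
Proof.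
pose psi0 : {rmorphism {poly k} -> B} := horner_eval x \o map_poly f.
exists (horner_eval y \o map_poly psi0); split=> [||c].
- by rewrite /= map_polyX /horner_eval hornerX.
- by rewrite /= map_polyC /horner_eval hornerC /psi0 /= /horner_eval map_polyX hornerX.
- by rewrite /= map_polyC /horner_eval hornerC /psi0 /= /horner_eval map_polyC hornerC.
Qed.

Lemma monomial_scale (B : comNzRingType) (c x y t : B) d e :
  c * (x * t) ^+ d * (y * t) ^+ e = c * x ^+ d * y ^+ e * t ^+ (d + e).
Proof. by rewrite !exprMn exprD; ring. Qed.

Section Homogenize.
Variables (k : fieldType) (a b : k).
Local Notation S := {mpoly k[3]}.
Local Notation A := {poly {poly k}}.

Definition pencil0 : S := 'X_ix - a *: 'X_iz.
Definition pencil1 : S := 'X_iy - b *: 'X_iz.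

Lemma homogXi i : ('X_i : S) \is 1.-homog.
Proof. by rewrite dhomogX; apply/eqP/mdeg1. Qed.

Lemma pencil0_homog : pencil0 \is 1.-homog.
Proof. by rewrite rpredB ?rpredZ ?homogXi. Qed.

Lemma pencil1_homog : pencil1 \is 1.-homog.
Proof. by rewrite rpredB ?rpredZ ?homogXi. Qed.

Lemma pencil1_neq0 : pencil1 != 0.
Proof.
apply/eqP=> /(congr1 (mcoeff U_(iy))) /eqP.
by rewrite mcoeffB mcoeffZ !mcoeffXU mcoeff0 /= mulr0 subr0 oner_eq0.
Qed.

(** With s an indeterminate the restriction to a line of the pencil loses
    nothing: it is the dehomogenization of g with respect to pencil1, in the
    affine coordinates s = pencil0 / pencil1 and Z = z / pencil1. *)
Definition dehomog : S -> A := to_line polyC 'X a%:P b%:P.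
HB.instance Definition _ := GRing.RMorphism.copy dehomog (to_line polyC 'X a%:P b%:P).

Lemma dehomog_pencil0 : dehomog pencil0 = 'X%:P.
Proof.
rewrite /dehomog rmorphB /= to_lineZ !to_lineX /=.
by rewrite addrK.
Qed.

Lemma dehomog_pencil1 : dehomog pencil1 = 1.
Proof. by rewrite /dehomog rmorphB /= to_lineZ !to_lineX /= addrK. Qed.

Lemma dehomogZ c g : dehomog (c *: g) = c%:P%:P * dehomog g.
Proof. by rewrite /dehomog to_lineZ mul_polyC. Qed.

(** Evaluating dehomog g at s = pencil0 / pencil1 and Z = z / pencil1, in the
    fraction field of S, gives back g / pencil1^i. *)
Lemma dehomog_inj i g : g \is i.-homog -> dehomog g = 0 -> g = 0.
Proof.
move=> hg g0; pose L := {fraction S}.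
pose y : L := (tofrac pencil1)^-1.
have nzy : tofrac pencil1 != 0 :> L by rewrite tofrac_eq0 pencil1_neq0.
have [psi [psiX psi0X psi0C]] := eval2_exists (@tofrac S \o @mpolyC 3 k)
  (tofrac pencil0 * y) (tofrac 'X_iz * y).
have := congr1 psi g0; rewrite rmorph0 /dehomog /to_line rmorph_mmap.
rewrite (@eq_mmap _ _ _ (@tofrac S \o @mpolyC 3 k) _
  (fun j => y * (@tofrac S \o (fun i => 'X_i)) j)); last first.
- move=> j; elim/ord3P: j => /=.
  + rewrite /line_pt /= -mul_polyC !rmorphD !rmorphM /= psiX psi0X psi0C.
    by rewrite /pencil0 rmorphB -mul_mpolyC rmorphM /=; ring.
  + rewrite /line_pt /= -mul_polyC !rmorphD !rmorphM rmorph1 /= psiX psi0C.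
    apply: (mulfI nzy); rewrite [RHS]mulrA mulfV // mul1r.
    rewrite mulrDr mulr1 mulrCA [_ * (_ * y)]mulrCA mulfV // mulr1.
    by rewrite /pencil1 rmorphB -mul_mpolyC rmorphM /= subrK.
  + by rewrite /line_pt /= psiX mulrC.
- by move=> c; rewrite /= psi0C.
rewrite (mmap_scale _ _ _ hg) -rmorph_mmap => /eqP.
rewrite mulf_eq0 expf_eq0 invr_eq0 (negbTE nzy) andbF /=.
rewrite tofrac_eq0 => /eqP; rewrite /mmap => e.
rewrite (mpolyE g) -[RHS]e; apply: eq_bigr => m _.
by rewrite mmap1_id mul_mpolyC.
Qed.

Definition const3 : k -> {poly A} := polyC \o (polyC \o polyC).
HB.instance Definition _ :=
  GRing.RMorphism.copy const3 (polyC \o (polyC \o polyC)).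

(** Substitutes s T for s and Z T for Z, where T is the new outermost variable.
    The T-degree of the result is the total degree in s and Z, which so becomes
    the size of a univariate polynomial over a domain and is additive. *)
Definition grade : {rmorphism A -> {poly A}} :=
  sval (@eval2_exists k {poly A} const3 ('X%:P%:P * 'X) ('X%:P * 'X)).

Lemma gradeX : grade 'X = 'X%:P * 'X.
Proof. by rewrite /grade; case: eval2_exists => psi []. Qed.
Lemma gradeY : grade 'X%:P = 'X%:P%:P * 'X.
Proof. by rewrite /grade; case: eval2_exists => psi []. Qed.
Lemma gradeC c : grade c%:P%:P = c%:P%:P%:P.
Proof. by rewrite /grade; case: eval2_exists => psi []. Qed.

Lemma grade_sum (P : A) :
  grade P = \sum_(c < size P) \sum_(d < size P`_c)
    (((P`_c)`_d)%:P%:P * 'X%:P ^+ d * 'X ^+ c)%:P * 'X^(d + c).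
Proof.
rewrite -{1}[P]coefK poly_def rmorph_sum; apply: eq_bigr => c _ /=.
rewrite -mul_polyC rmorphM rmorphXn /= gradeX.
rewrite -{1}[P`_c]coefK poly_def !rmorph_sum mulr_suml; apply: eq_bigr => d _ /=.
rewrite -mul_polyC !rmorphM !rmorphXn /= gradeC gradeY.
exact: monomial_scale.
Qed.

Lemma grade_eval1 (P : A) : (grade P).[1] = P.
Proof.
rewrite grade_sum horner_sum -[RHS]coefK poly_def; apply: eq_bigr => c _ /=.
rewrite horner_sum -[in RHS](coefK P`_c) poly_def -mul_polyC rmorph_sum mulr_suml.
apply: eq_bigr => d _ /=.
rewrite hornerM hornerXn expr1n mulr1 hornerC; congr (_ * _).
by rewrite -mul_polyC polyCM polyC_exp.
Qed.

Lemma grade_neq0 P : P != 0 -> grade P != 0.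
Proof. by apply: contraNneq => P0; rewrite -(grade_eval1 P) P0 horner0. Qed.

Lemma grade_coef P n : exists2 g : S, g \is n.-homog & dehomog g = (grade P)`_n.
Proof.
pose Q F := exists2 g : S, g \is n.-homog & dehomog g = F.
have Q0 : Q 0 by exists 0; [exact: rpred0 | exact: rmorph0].
have QD : forall u v, Q u -> Q v -> Q (u + v).
  move=> u v [g hg <-] [h hh <-]; exists (g + h); first exact: rpredD.
  by rewrite rmorphD.
rewrite -/(Q _) grade_sum coef_sum; apply: (big_ind Q) => // c _.
rewrite coef_sum; apply: (big_ind Q) => // d _.
rewrite coefCM coefXn; case: eqP => [nE|_]; last by rewrite mulr0.
rewrite mulr1; exists ((P`_c)`_d *: (pencil0 ^+ d * 'X_iz ^+ c)).
  rewrite nE; apply: rpredZ; apply: dhomogM.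
    by have := dhomogMn d pencil0_homog; rewrite mul1n.
  by have := dhomogMn c (homogXi iz); rewrite mul1n.
rewrite dehomogZ rmorphM !rmorphXn /= dehomog_pencil0 /dehomog to_lineX /=.
by rewrite mulrA.
Qed.

Lemma homogenize P i : (size (grade P) <= i.+1)%N ->
  exists2 g : S, g \is i.-homog & dehomog g = P.
Proof.
move=> sP; pose Q F := exists2 g : S, g \is i.-homog & dehomog g = F.
rewrite -(grade_eval1 P) -/(Q _) horner_coef.
apply: (big_ind Q); first by exists 0; [exact: rpred0 | exact: rmorph0].
  move=> u v [g hg <-] [h hh <-]; exists (g + h); first exact: rpredD.
  by rewrite rmorphD.
move=> n _; have [g hg <-] := grade_coef P n.
have le_ni : (n <= i)%N by rewrite -ltnS (leq_trans _ sP).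
exists (g * pencil1 ^+ (i - n)).
  rewrite -{2}(subnKC le_ni); apply: dhomogM => //.
  by have := dhomogMn (i - n) pencil1_homog; rewrite mul1n.
by rewrite rmorphM rmorphXn /= dehomog_pencil1 !expr1n.
Qed.

Lemma size_grade_dehomog i g : g \is i.-homog -> (size (grade (dehomog g)) <= i.+1)%N.
Proof.
move=> hg; apply: (@size_rmorph_mmap A A k grade (polyC \o polyC) (polyC \o polyC)
    (line_pt 'X a%:P b%:P) i g _ _ hg) => [c|j].
  exact: gradeC.
have sX (p : A) : (size (p%:P * 'X)%R <= 2)%N.
  by rewrite (leq_trans (size_polyMleq _ _)) // size_polyX addnS addn1 /= ltnS size_polyC_leq1.
elim/ord3P: j; rewrite /line_pt /=.
- rewrite -mul_polyC rmorphD rmorphM gradeC gradeX gradeY.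
  apply: leq_trans (size_polyD _ _) _; rewrite geq_max; apply/andP; split; first exact: sX.
  by rewrite (leq_trans _ (sX (a%:P%:P * 'X))) // polyCM mulrA.
- rewrite -mul_polyC rmorphD rmorphM rmorph1 gradeC gradeX.
  apply: leq_trans (size_polyD _ _) _; rewrite geq_max size_poly1 /=.
  by rewrite (leq_trans _ (sX (b%:P%:P * 'X))) // polyCM mulrA.
- by rewrite gradeX sX.
Qed.

(** G is the homogenization of F. Additivity of the total degree bounds the
    degree of the cofactor q by j - f, so that q homogenizes in degree j - f;
    injectivity of dehomogenization brings the factorization back to S. *)
Lemma dehomog_factor (F : A) : F != 0 ->
  exists f, exists2 G : S, G \is f.-homog & dehomog G = F /\
   forall j g, g \is j.-homog -> g != 0 -> (exists q, dehomog g = F * q) ->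
     exists2 j', j = (f + j')%N & exists2 h, h \is j'.-homog & g = G * h.
Proof.
move=> nzF; exists (size (grade F)).-1.
have sF0 : (0 < size (grade F))%N by rewrite size_poly_gt0 grade_neq0.
have [|G hG GF] := @homogenize F (size (grade F)).-1; first by rewrite prednK.
exists G => //; split=> // j g hg nzg [q gq].
have nzq : q != 0.
  apply: contra_neq nzg => q0; apply: (dehomog_inj hg).
  by rewrite gq q0 mulr0.
have sq0 : (0 < size (grade q))%N by rewrite size_poly_gt0 grade_neq0.
have := size_grade_dehomog hg; rewrite gq rmorphM size_mul ?grade_neq0 //=.
move: sq0 sF0 (@homogenize q) GF hG.
move: (size (grade q)) (size (grade F)) => sq [//|sF] sq0 _ hom GF hG /= sz.
exists (j - sF)%N; first by lia.
have [|h hh hq] := hom (j - sF)%N; first by lia.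
exists h => //; apply/eqP; rewrite -subr_eq0; apply/eqP.
apply: (@dehomog_inj j); last by rewrite rmorphB rmorphM /= GF hq gq subrr.
rewrite rpredB //; have {1}-> : j = (sF + (j - sF))%N by lia.
exact: dhomogM.
Qed.

End Homogenize.

(** * Gauss's lemma over a polynomial ring in one variable *)
Section Gauss.
Variable k : fieldType.
Local Notation A := {poly {poly k}}.
Local Notation K := {fraction {poly k}}.

(** Over the principal ideal domain k[s] this is primitivity, phrased as a
    Bezout relation. *)
Definition unimodular (F : A) := exists u : nat -> {poly k},
  \sum_(i < size F) u i * F`_i = 1.

Lemma bezout_seq (c : nat -> {poly k}) n : exists d (u : nat -> {poly k}),
  d = \sum_(i < n) u i * c i /\ forall i, (i < n)%N -> d %| c i.
Proof.
elim: n => [|n [d [u [du dc]]]].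
  by exists 0, (fun=> 0); rewrite big_ord0.
have [[v w] /= vw] := Bezoutp d (c n).
exists (v * d + w * c n), (fun i => if i == n then w else v * u i).
have dv x : (gcdp d (c n) %| x) -> (v * d + w * c n) %| x.
  by rewrite (eqp_dvdl _ vw).
split=> [|i].
  rewrite big_ord_recr /= eqxx; congr (_ + _).
  rewrite du mulr_sumr; apply: eq_bigr => i _.
  by rewrite ltn_eqF // mulrA.
rewrite ltnS leq_eqVlt => /orP[/eqP->|/dc dci]; apply: dv.
  exact: dvdp_gcdr.
exact: dvdp_trans (dvdp_gcdl _ _) dci.
Qed.

Lemma primitive_part (F : A) : F != 0 ->
  exists d F', [/\ d != 0, F = d *: F' & unimodular F'].
Proof.
move=> nzF; have [d [u [du dF]]] := bezout_seq (fun i => F`_i) (size F).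
have nzd : d != 0.
  apply: contra_neq nzF => d0; apply/polyP=> i; rewrite coef0.
  have [lt|ge] := ltnP i (size F); last exact: nth_default.
  by have := dF i lt; rewrite d0 dvd0p => /eqP.
pose F' : A := \poly_(i < size F) (F`_i %/ d).
have FF' : F = d *: F'.
  apply/polyP=> i; rewrite coefZ coef_poly; case: ltnP => [lt|ge].
    by rewrite mulrC divpK ?dF.
  by rewrite mulr0 nth_default.
exists d, F'; split=> //; exists u.
have cF i : F`_i = d * F'`_i by rewrite {1}FF' coefZ.
have szF : size F' = size F by rewrite [in RHS]FF' size_scale.
apply: (mulfI nzd); rewrite mulr1 [RHS]du szF mulr_sumr.
by apply: eq_bigr => i _; rewrite cF mulrCA.
Qed.

(** This is Gauss's lemma, proved as McCoy's theorem over k[s]/(a): a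
    nonzero polynomial killed by F can be replaced by a nonzero constant killed
    by F, and a constant killed by a unimodular F is zero. Prime factors of a
    never enter. The descent runs on the size of q and, inside, on i from the
    top coefficient of F downwards: a divides F_j q for all j > i, so comparing
    coefficients shows that a divides F_i times the leading coefficient of q;
    the rest of F_i q has smaller size and is still killed by F modulo a. *)
Lemma unimodular_dvd (F : A) (a : {poly k}) : unimodular F ->
  forall q, (exists r, F * q = a *: r) -> exists q', q = a *: q'.
Proof.
move=> [u uF] q; move: {2}(size q) (leqnn (size q)) => n.
elim: n q => [|n IH] q.
  by rewrite leqn0 size_poly_eq0 => /eqP-> _; exists 0; rewrite scaler0.
move=> sq [r Fq].
have key i : exists q', F`_i *: q = a *: q'.
  have [m] := ubnP (size F - i)%N; elim: m i => // m IHm i lt_m.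
  have [ge|lt_i] := leqP (size F) i.
    by exists 0; rewrite nth_default // scale0r scaler0.
  pose q1 := q - (q`_n)%:P * 'X^n.
  have sq1 : (size q1 <= n)%N.
    apply/leq_sizeP=> j le_nj; rewrite coefB coefCM coefXn.
    case: (ltngtP j n) le_nj => // [lt_nj|->] _; last by rewrite mulr1 subrr.
    by rewrite mulr0 subr0 nth_default // (leq_trans sq).
  have [c ac] : exists c, F`_i * q`_n = a * c.
    have /(congr1 (fun P : A => P`_(i + n))) := Fq.
    rewrite coefM coefZ.
    have lt0 : (i < (i + n).+1)%N by rewrite ltnS leq_addr.
    rewrite (bigD1 (Ordinal lt0)) //= addKn => e.
    suff [c' ->] : exists c', F`_i * q`_n = a * r`_(i + n) - a * c'.
      by exists (r`_(i + n) - c'); rewrite mulrBr.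
    have [c' c'E] : exists c', \sum_(j < (i + n).+1 | j != Ordinal lt0)
        F`_j * q`_(i + n - j) = a * c'.
      apply: (big_ind (fun x => exists c', x = a * c')).
      - by exists 0; rewrite mulr0.
      - by move=> x y [x' ->] [y' ->]; exists (x' + y'); rewrite mulrDr.
      move=> j nj; have {}nj : (j : nat) != i.
        by apply: contraNneq nj => ji; apply/eqP/val_inj.
      case: (ltngtP j i) nj => // ji _.
        exists 0; rewrite [q`__]nth_default ?mulr0 // (leq_trans sq) //.
        by rewrite ltn_subRL; lia.
      have [|q' /(congr1 (fun P : A => P`_(i + n - j)))] := IHm j; first by lia.
      by rewrite !coefZ => ->; exists (q'`_(i + n - j)).
    by exists c'; rewrite -c'E -e addrK.
  have acP : (F`_i)%:P * (q`_n)%:P = a%:P * c%:P :> A by rewrite -!polyCM ac.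
  have [||q2 q2E] := IH (F`_i *: q1).
  - exact: leq_trans (size_scale_leq _ _) sq1.
  - exists (F`_i *: r - (c%:P * (F * 'X^n))).
    rewrite /q1 -scalerAr mulrBr Fq !scalerBr; congr (_ - _).
      by rewrite !scalerA mulrC.
    rewrite -!mul_polyC; transitivity ((F`_i)%:P * (q`_n)%:P * (F * 'X^n)).
      by ring.
    by rewrite acP; ring.
  exists (q2 + c%:P * 'X^n); rewrite scalerDr -q2E /q1 scalerBr.
  rewrite -[a *: (_ * _)]mul_polyC mulrA -acP -!mul_polyC; ring.
have [q' qE] : exists q', \sum_(i < size F) (u i * F`_i) *: q = a *: q'.
  apply: (big_ind (fun x => exists c', x = a *: c')).
  - by exists 0; rewrite scaler0.
  - by move=> x y [x' ->] [y' ->]; exists (x' + y'); rewrite scalerDr.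
  move=> i _; have [q' q'E] := key i.
  by exists (u i *: q'); rewrite -scalerA q'E !scalerA mulrC.
by exists q'; rewrite -qE -scaler_suml uF scale1r.
Qed.

Lemma frac_repr (x : K) : exists n d : {poly k},
  d != 0 /\ x * tofrac d = tofrac n.
Proof.
elim/quotW: x => r; exists (frac r).1, (frac r).2; split; first exact: denom_ratioP.
rewrite -[LHS]/(FracField.mul _ _) !piE.
apply/eqmodP; rewrite /= FracField.equivfE /FracField.mulf.
by rewrite !numden_Ratio ?(oner_eq0, mulf_neq0, denom_ratioP) // !mulr1 mulrC.
Qed.

Local Notation lift := (map_poly (@tofrac {poly k})).

Lemma map_tofrac_inj : injective lift.
Proof. by apply: map_inj_poly; [move=> x y /eqP; rewrite tofrac_eq => /eqP | exact: tofrac0]. Qed.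

Lemma clear_denom (P : {poly K}) : exists (c : {poly k}) (Q : A),
  c != 0 /\ lift Q = (tofrac c) *: P.
Proof.
elim/poly_ind: P => [|P x [c [Q [nzc QE]]]].
  by exists 1, 0; rewrite oner_neq0 rmorph0 scaler0.
have [n [d [nzd xd]]] := frac_repr x.
exists (c * d), (d *: Q * 'X + (c * n)%:P); split; first by rewrite mulf_neq0.
rewrite rmorphD rmorphM /= map_polyX map_polyC map_polyZ QE /= !tofracM -xd.
rewrite scalerDr -!scalerAl scalerA [X in X *: _]mulrC; congr (_ + _).
by rewrite -[RHS]mul_polyC -polyCM; congr (_%:P); rewrite mulrA mulrAC.
Qed.

(** F is the primitive part of G with denominators cleared; unimodular_dvd
    removes the denominators of the cofactor. *)
Lemma gauss_factor (G : {poly K}) : (1 < size G)%N ->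
  exists2 F : A, (1 < size F)%N &
    forall f : A, G %| lift f -> exists q, f = F * q.
Proof.
move=> sG; have [c [F0 [nzc F0E]]] := clear_denom G.
have nzG : G != 0 by rewrite -size_poly_gt0 ltnW.
have nzF0 : F0 != 0.
  apply/eqP=> F00; move/eqP: F0E.
  by rewrite F00 rmorph0 eq_sym scaler_eq0 tofrac_eq0 (negbTE nzc) (negbTE nzG).
have [d [F [nzd F0F uF]]] := primitive_part nzF0.
have FG : lift F %= G.
  have : tofrac d *: lift F = tofrac c *: G by rewrite -F0E F0F map_polyZ.
  move=> e; apply/eqpP; exists (tofrac d, tofrac c) => //=.
  by rewrite !tofrac_eq0 nzd nzc.
exists F.
  rewrite -(eqp_size FG) size_map_inj_poly ?tofrac0 // in sG *.
  by move=> x y /eqP; rewrite tofrac_eq => /eqP.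
move=> f; rewrite -(eqp_dvdl _ FG) => /dvdpP[Q fQ].
have [a [q [nza qE]]] := clear_denom Q.
have [|q' q'E] := @unimodular_dvd F a uF q.
  exists f; apply: map_tofrac_inj.
  by rewrite rmorphM /= qE map_polyZ /= fQ -scalerAr mulrC.
exists q'; apply: map_tofrac_inj; apply: (@scalerI _ _ (tofrac a)).
  by rewrite tofrac_eq0.
by rewrite fQ -[RHS]map_polyZ [a *: (F * q')]scalerAr -q'E rmorphM /= qE -scalerAr mulrC.
Qed.

End Gauss.

(** * Spaces of polynomials of minimal growth *)
Section Window.
Variables (K : fieldType) (n m1 m2 j : nat).
Variables (W : 'M[K]_(m1, n)) (W' : 'M[K]_(m2, n)).

(** Subspaces of polynomials of size at most n are row spaces; one n serves
    for all degrees, so that spaces from different degrees can be compared. *)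
Definition rows_in m (V : 'M[K]_(m, n)) (f : {poly K}) : bool :=
  (size f <= n)%N && (poly_rV f <= V)%MS.

Lemma rows_inD m (V : 'M[K]_(m, n)) c f g :
  rows_in V f -> rows_in V g -> rows_in V (c *: f + g).
Proof.
move=> /andP[sf Vf] /andP[sg Vg]; apply/andP; split.
  rewrite (leq_trans (size_polyD _ _)) // geq_max sg andbT.
  exact: leq_trans (size_scale_leq _ _) sf.
by rewrite linearP addmx_sub // scalemx_sub.
Qed.

Lemma rows_inP m (V : 'M[K]_(m, n)) (u : 'rV_n) :
  rows_in V (rVpoly u) = (u <= V)%MS.
Proof. by rewrite /rows_in size_poly rVpolyK. Qed.

Hypotheses (lt_jn : (j.+1 < n)%N)
  (szW : forall f, rows_in W f -> (size f <= j.+1)%N)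
  (WW' : (W <= W')%MS)
  (XW : forall f, rows_in W f -> rows_in W' ('X * f)).

(** Equality of ranks would make W stable under multiplication by X, against
    the bound on sizes. *)
Lemma window_rank_lt : W != 0 -> (\rank W < \rank W')%N.
Proof.
move=> nzW; rewrite ltn_neqAle mxrankS // andbT; apply/negP=> eqr.
have W'W : (W' <= W)%MS by rewrite -mxrank_leqif_sup.
have [i nzi] : exists i, row i W != 0.
  apply/existsP; rewrite -negb_forall; apply: contra nzW => /forallP W0.
  by apply/eqP/row_matrixP=> i; rewrite row0; apply/eqP.
have inX t : rows_in W ('X^t * rVpoly (row i W)).
  elim: t => [|t IH]; first by rewrite expr0 mul1r rows_inP row_sub.
  have /andP[sf /submx_trans Wf] := XW IH.
  by rewrite exprS -mulrA /rows_in sf Wf.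
have nzp : rVpoly (row i W) != 0.
  by apply: contraNneq nzi => r0; rewrite -[row _ _]rVpolyK r0 linear0.
have := szW (inX j.+1); rewrite mulrC size_mulXn //.
by rewrite -size_poly_gt0 in nzp; lia.
Qed.

Hypotheses (rkW' : (\rank W' = (\rank W).+1)%N)
  (ltW : (\rank W < j.+1)%N)
  (fj : {poly K}) (Wfj : rows_in W fj) (szfj : size fj = j.+1).

(** W' contains X fj, of size j + 2, outside W. As W has codimension one
    in W', every element of W' of size at most j + 1 is already in W. *)
Lemma window_closed f : rows_in W' f -> (size f <= j.+1)%N -> rows_in W f.
Proof.
move=> /andP[sfn W'f] sf; rewrite /rows_in sfn /=; apply/negPn/negP=> nWf.
have lt : (\rank W < \rank (W + poly_rV f)%MS)%N.
  rewrite (ltn_leqif (mxrank_leqif_sup _)) ?addsmxSl //.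
  by apply: contra nWf; apply: submx_trans; rewrite addsmxSr.
have sub : (W + poly_rV f <= W')%MS by rewrite addsmx_sub WW'.
have W'sub : (W' <= W + poly_rV f)%MS.
  by rewrite -mxrank_leqif_sup // rkW' eqn_leq lt -rkW' mxrankS.
have /andP[_ /submx_trans/(_ W'sub)/sub_addsmxP[[u v] /= e]] := XW Wfj.
have : ('X * fj)`_j.+1 != 0.
  by rewrite coefXM /= -[j]/(j.+1.-1) -szfj -lead_coefE lead_coef_eq0 -size_poly_gt0 szfj.
have sX : (size ('X * fj)%R <= n)%N.
  rewrite mulrC size_mulX ?szfj //; by rewrite -size_poly_gt0 szfj.
have -> : ('X * fj)`_j.+1 = poly_rV (d:=n) ('X * fj) 0 (Ordinal lt_jn).
  by rewrite mxE.
rewrite e mxE -[u *m W]rVpolyK mxE nth_default; last first.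
  by apply: szW; rewrite rows_inP submxMl.
rewrite add0r mxE big1 ?eqxx // => i _.
by rewrite mxE /= nth_default ?mulr0.
Qed.

Lemma window_mul G q : rows_in W G -> (size (q * G)%R <= j.+1)%N ->
  rows_in W (q * G).
Proof.
have W0 : rows_in W 0 by rewrite /rows_in size_poly0 linear0 sub0mx.
move=> WG; elim/poly_ind: q => [|q c IH]; first by rewrite mul0r.
have [-> _|nzq] := eqVneq q 0.
  by rewrite mul0r add0r mul_polyC -[_ *: _]addr0 rows_inD.
have [-> _|nzG] := eqVneq G 0; first by rewrite mulr0.
have cE : (q * 'X + c%:P) * G = c *: G + 'X * (q * G).
  by rewrite -mul_polyC; ring.
have szE : size ((q * 'X + c%:P) * G) = (size (q * G)).+1.
  have s1 : size (q * 'X + c%:P) = (size q).+1.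
    by rewrite size_MXaddC (negbTE nzq).
  rewrite size_mul //; last by rewrite -size_poly_gt0 s1.
  by rewrite s1 size_mul // prednK // addn_gt0 size_poly_gt0 nzq.
rewrite szE => sz; rewrite cE rows_inD //.
apply: window_closed; first by apply: XW; apply: IH; apply: ltnW.
by rewrite mulrC size_mulX // mulf_neq0.
Qed.

(** By window_closed, W is stable under multiplication by X as long as sizes
    permit, so Euclidean division can be carried out inside W: a nonzero element
    of least size divides all of W. It is not constant, since multiples of a
    constant would fill all polynomials of size at most j + 1. The element
    fj of full size is essential: without it the common factor could
    sit at infinity, as for the polynomials of small degree. *)
Lemma window_gcd : exists2 G : {poly K}, (1 < size G)%N &
  forall f, rows_in W f -> G %| f.
Proof.
(* Search by decreasing size: if G fails to divide some row of W, the remainder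
   is a smaller nonzero element of W. *)
have exG s G : rows_in W G -> G != 0 -> (size G <= s)%N ->
    exists2 G, rows_in W G /\ G != 0 & forall f, rows_in W f -> G %| f.
  elim: s G => [|s IH] G WG nzG sG.
    by move: nzG; rewrite -size_poly_gt0; case: size sG.
  have [alldiv|] := boolP [forall i, G %| rVpoly (row i W)].
    exists G => // f /andP[sf /submxP[D fD]].
    have -> : f = \sum_i D 0 i *: rVpoly (row i W).
      rewrite -(poly_rV_K sf) fD mulmx_sum_row linear_sum.
      by apply: eq_bigr => i _; rewrite linearZ.
    by apply: (big_ind (fun p => G %| p)) => [|p q|i _];
      [exact: dvdp0 | exact: dvdp_add | rewrite -mul_polyC dvdp_mull //; exact: (forallP alldiv)].
  rewrite negb_forall => /existsP[i]; set f := rVpoly _ => nGf.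
  have Wf : rows_in W f by rewrite rows_inP row_sub.
  have nzr : f %% G != 0 by rewrite -/(dvdp _ _).
  apply: (IH (f %% G)) => //; last first.
    by rewrite -ltnS (leq_trans _ sG) // ltn_modp.
  have -> : f %% G = (-1) *: (f %/ G * G) + f.
    by rewrite {3}(divp_eq f G) scaleN1r addKr.
  apply: rows_inD => //; apply: window_mul => //.
  apply: leq_trans (szW Wf).
  have [->|nzq] := eqVneq (f %/ G) 0; first by rewrite mul0r size_poly0.
  rewrite {2}(divp_eq f G) size_polyDl // (leq_trans (n:= size G)) ?ltn_modp //.
  rewrite size_mul // -(prednK (n := size (f %/ G))) ?size_poly_gt0 // addSn /=.
  exact: leq_addl.
have [||G [WG nzG] GW] := exG j.+1 fj Wfj.
- by rewrite -size_poly_gt0 szfj.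
- by rewrite szfj.
exists G => //; rewrite ltnNge; apply/negP => sG1.
have /size_poly1P[c nzc cG] : size G == 1%N.
  by rewrite eqn_leq sG1 size_poly_gt0.
have lt_rank : (\rank (pid_mx j.+1 : 'M[K]_n) <= \rank W)%N.
  apply: mxrankS; apply/row_subP => i.
  have [ge|lt] := leqP j.+1 i.
    have -> : row i (pid_mx j.+1 : 'M[K]_n) = 0; last exact: sub0mx.
    by apply/rowP=> t; rewrite !mxE ltnNge ge andbF.
  have : rows_in W ((c^-1 *: 'X^i) * G).
    apply: window_mul => //; rewrite cG mulrC mul_polyC scalerA mulfV //.
    by rewrite scale1r size_polyXn.
  rewrite cG mulrC mul_polyC scalerA mulfV // scale1r => /andP[_].
  apply: submx_trans; rewrite (_ : row i _ = poly_rV 'X^i) //.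
  by apply/rowP=> t; rewrite !mxE coefXn lt andbT eq_sym.
by move: lt_rank; rewrite rank_pid_mx ?(ltnW lt_jn) // leqNgt ltW.
Qed.

End Window.

(** * Annihilated forms restricted to a line *)
Section LineSection.
Variables (K : fieldType) (s al be : K).
Local Notation S := {mpoly K[3]}.
Local Notation rhoK := (to_line idfun s al be).

Definition pencil_line : S := pencil0 al - s *: pencil1 be.

Lemma pencil_line_homog : pencil_line \is 1.-homog.
Proof. by rewrite rpredB ?rpredZ ?pencil0_homog ?pencil1_homog. Qed.

Lemma pencil_line_neq0 : pencil_line != 0.
Proof.
apply/eqP=> /(congr1 (mcoeff U_(ix))) /eqP.
rewrite !(mcoeffB, mcoeffZ, mcoeffXU) mcoeff0 /=.
by rewrite !mulr0 !subr0 mulr0 subr0 oner_eq0.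
Qed.

Lemma to_line_pencil1 : rhoK (pencil1 be) = 1.
Proof. by rewrite rmorphB /= to_lineZ !to_lineX /= addrK. Qed.

Lemma to_line_pencil_line : rhoK pencil_line = 0.
Proof.
rewrite rmorphB /= to_lineZ to_line_pencil1 rmorphB /= to_lineZ !to_lineX /=.
by rewrite addrK alg_polyC subrr.
Qed.

Definition to_line_mx i n : 'M[K]_(nmons i, n) := \matrix_p poly_rV (rhoK 'X_[mon p]).

Lemma mul_to_line_mx i n (u : 'rV_(nmons i)) :
  u *m to_line_mx i n = poly_rV (rhoK (form_of u)).
Proof.
rewrite mulmx_sum_row /form_of rmorph_sum linear_sum; apply: eq_bigr => p _ /=.
by rewrite rowK to_lineZ linearZ.
Qed.

Lemma rank_to_line_mx i n : (i < n)%N -> \rank (to_line_mx i n) = i.+1.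
Proof.
move=> lt_in.
suff -> : \rank (to_line_mx i n) = \rank (pid_mx i.+1 : 'M[K]_n).
  exact: rank_pid_mx.
apply: eqmx_rank.
apply/andP; split; apply/row_subP=> p.
  have -> : row p (to_line_mx i n) = row p (to_line_mx i n) *m pid_mx i.+1.
    apply/rowP=> t; rewrite [in RHS]mxE (bigD1 t) //= big1 ?addr0 => [|q nqt].
      rewrite rowK !mxE eqxx /=; case: ltnP => [_|le]; first by rewrite mulr1.
      rewrite mulr0 nth_default // (leq_trans (size_to_line _ _ _ _ (i := i) _)) //.
      by rewrite dhomogX; apply/eqP/mdeg_mon.
    by rewrite !mxE [_ == _](_ : _ = false) ?mulr0 //; apply/negbTE.
  exact: submxMl.
have [ge|lt] := leqP i.+1 p.
  have -> : row p (pid_mx i.+1 : 'M[K]_n) = 0; last exact: sub0mx.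
  by apply/rowP=> t; rewrite !mxE ltnNge ge andbF.
have -> : row p (pid_mx i.+1 : 'M[K]_n) = poly_rV 'X^p.
  by apply/rowP=> t; rewrite !mxE coefXn lt andbT eq_sym.
pose g : S := pencil1 be ^+ (i - p) * 'X_iz ^+ p.
have hg : g \is i.-homog.
  rewrite -(subnK (n := i) (m := p)) //; apply: dhomogM.
    by have := dhomogMn (i - p) (pencil1_homog be); rewrite mul1n.
  by have := dhomogMn p (homogXi K iz); rewrite mul1n.
have -> : 'X^p = rhoK g.
  by rewrite rmorphM !rmorphXn /= to_line_pencil1 expr1n mul1r to_lineX.
by rewrite -(coordsK hg) -mul_to_line_mx submxMl.
Qed.

(** The forms vanishing on a line are the multiples of its equation: these are
    among them, and the dimensions agree. *)
Lemma ker_to_line_mx i n : (i.+1 < n)%N ->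
  (kermx (to_line_mx i.+1 n) :=: mulform pencil_line i i.+1)%MS.
Proof.
move=> lt_in; apply/eqmx_sym/eqmxP; rewrite -mxrank_leqif_eq.
  rewrite mxrank_ker rank_to_line_mx // [X in _ == (X - _)%N]nmons_succ addnK.
  exact: mulform_free pencil_line_homog (add1n _) pencil_line_neq0.
apply/sub_kermxP/row_matrixP=> p; rewrite row0 row_mul mul_to_line_mx rowE.
by rewrite (form_mulform pencil_line_homog) // rmorphM /= to_line_pencil_line mul0r linear0.
Qed.

Variable mu : 'X_{1..3} -> K.

(** The space called J_i in the introduction, where e = d - i. *)
Definition ann_line n i e : 'M[K]_(nmons i, n) := kermx (catal mu i e) *m to_line_mx i n.

Lemma ann_lineP n i e f : (i < n)%N -> rows_in (ann_line n i e) f <->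
  exists g, [/\ g \is i.-homog, forall h, h \is e.-homog -> ev mu (g * h) = 0
    & f = rhoK g].
Proof.
move=> lt_in; split=> [/andP[sf /submxP[D fD]]|[g [hg g0 ->]]].
  exists (form_of (D *m kermx (catal mu i e))); split.
  - exact: form_of_homog.
  - by apply/catal_kerP; rewrite -mulmxA mulmx_ker mulmx0.
  rewrite -(poly_rV_K sf) fD mulmxA mul_to_line_mx poly_rV_K //.
  by apply: leq_trans (size_to_line _ _ _ _ (form_of_homog _)) _.
rewrite /rows_in (leq_trans (size_to_line _ _ _ _ hg)) //= -(coordsK hg) -mul_to_line_mx.
apply: submxMr; apply/sub_kermxP/eqP/catal_kerP => h hh.
by rewrite coordsK // g0.
Qed.

(** Exactness of R_i -> R_(i+1) -> (R/lR)_(i+1) -> 0, where l is the line and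
    the last space is K[Z] in degrees at most i + 1 modulo J_(i+1), counted
    without subtraction. The rank on the right is that of multiplication by l;
    it is symmetric in i and e. *)
Lemma rank_ann_line n i e : (i.+1 < n)%N ->
  (\rank (ann_line n i.+1 e) + \rank (catal mu i.+1 e) =
   i.+2 + \rank (catal (contract mu pencil_line) i e))%N.
Proof.
move=> lt_in; pose X := mulform pencil_line i i.+1; pose M := catal mu i.+1 e.
have h1 := mxrank_mul_ker (kermx M) (to_line_mx i.+1 n).
have h2 := mxrank_mul_ker X M.
have XM : X *m M = catal (contract mu pencil_line) i e.
  by apply: mulform_catal pencil_line_homog _ _ _.
have rX : \rank X = nmons i.
  by apply/eqP; exact: mulform_free pencil_line_homog (add1n _) pencil_line_neq0.
have rcap : \rank (kermx M :&: kermx (to_line_mx i.+1 n))%MS = \rank (X :&: kermx M)%MS.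
  by rewrite capmxC (cap_eqmx (ker_to_line_mx lt_in) (eqmx_refl _)).
have := rank_leq_row M; have := nmons_succ i.
rewrite -/X -/M -/(ann_line _ _ _) mxrank_ker in h1.
move: h1 h2; rewrite rcap XM rX /ann_line -/M.
lia.
Qed.

(** pencil1 restricts to the constant 1, and z to the variable. *)
Lemma ann_line_sub n i e : (i.+1 < n)%N ->
  (ann_line n i e.+1 <= ann_line n i.+1 e)%MS.
Proof.
move=> lt_in; apply/row_subP=> p; rewrite -rows_inP.
have /(@ann_lineP _ _ _ _ (ltnW lt_in))[g [hg g0 ->]] :
  rows_in (ann_line n i e.+1) (rVpoly (row p (ann_line n i e.+1))).
  by rewrite rows_inP row_sub.
apply/ann_lineP => //; exists (pencil1 be * g); split.
- exact: (dhomogM (pencil1_homog be) hg).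
- move=> h hh; rewrite mulrAC [_ * g]mulrC; apply: g0.
  exact: (dhomogM (pencil1_homog be) hh).
- by rewrite rmorphM /= to_line_pencil1 mul1r.
Qed.

Lemma ann_lineX n i e f : (i.+1 < n)%N ->
  rows_in (ann_line n i e.+1) f -> rows_in (ann_line n i.+1 e) ('X * f).
Proof.
move=> lt_in /(@ann_lineP _ _ _ _ (ltnW lt_in))[g [hg g0 ->]].
apply/ann_lineP => //; exists ('X_iz * g); split.
- exact: (dhomogM (homogXi _ _) hg).
- move=> h hh; rewrite mulrAC [_ * g]mulrC; apply: g0.
  exact: (dhomogM (homogXi _ _) hh).
- by rewrite rmorphM /= to_lineX.
Qed.

Lemma size_ann_line n i e f : (i < n)%N ->
  rows_in (ann_line n i e) f -> (size f <= i.+1)%N.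
Proof. by move=> lt_in /ann_lineP[] // g [hg _ ->]; exact: size_to_line. Qed.

Lemma ann_line_lt n i e : (i.+1 < n)%N -> ann_line n i e.+1 != 0 ->
  (\rank (ann_line n i e.+1) < \rank (ann_line n i.+1 e))%N.
Proof.
move=> lt_in; apply: window_rank_lt (lt_in) _ _ _.
- by move=> f; apply: size_ann_line; apply: ltnW.
- exact: ann_line_sub.
- by move=> f; apply: ann_lineX.
Qed.

Lemma ann_line_add n i e t : (i + t < n)%N -> ann_line n i (e + t) != 0 ->
  (\rank (ann_line n i (e + t)) + t <= \rank (ann_line n (i + t) e))%N.
Proof.
elim: t e => [|t IH] e lt nz; first by rewrite !addn0.
rewrite addnS -addSn in nz *; rewrite addnS in lt.
have le := IH e.+1 (ltnW lt) nz.
rewrite [(i + _)%N]addnS addnS; apply: leq_ltn_trans (le) _.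
apply: ann_line_lt => //; rewrite -mxrank_eq0 -lt0n.
by apply: leq_trans _ le; rewrite addn_gt0 lt0n mxrank_eq0 nz.
Qed.

End LineSection.

(** * Specializing a generic rank *)
Section Specialize.

Lemma maxminor (K : fieldType) m n (A : 'M[K]_(m, n)) :
  exists (f : 'I_(\rank A) -> 'I_m) (g : 'I_(\rank A) -> 'I_n),
    \det (mxsub f g A) != 0.
Proof.
pose B := rowsub (maxrankfun A) A.
have fullB : row_full B^T.
  by rewrite /row_full mxrank_tr; exact: maxrowsub_free.
exists (maxrankfun A), (fullrankfun fullB).
have := fullrowsub_unit fullB; rewrite unitmxE unitfE -det_tr.
by congr (\det _ != 0); apply/matrixP=> i j; rewrite !mxE.
Qed.

Lemma minor_rank (K : fieldType) m n r (A : 'M[K]_(m, n))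
    (f : 'I_r -> 'I_m) (g : 'I_r -> 'I_n) :
  \det (mxsub f g A) != 0 -> (r <= \rank A)%N.
Proof.
rewrite -unitfE -unitmxE => /mxrank_unit <-; rewrite mxsubrc.
apply: leq_trans (mxrankS (rowsub_sub _ _)) _.
rewrite -mxrank_tr (_ : _^T = rowsub g A^T); last by apply/matrixP=> i j; rewrite !mxE.
by rewrite (leq_trans (mxrankS (rowsub_sub _ _))) // mxrank_tr.
Qed.

Variable k : fieldType.
Hypothesis infk : infinite_field k.

Lemma infinite_uniq n : exists2 rs : seq k, uniq rs & size rs = n.
Proof.
elim: n => [|n [rs urs szrs]]; first by exists [::].
by have [x nx] := infk rs; exists (x :: rs); rewrite /= ?nx ?szrs.
Qed.

Lemma nonroot (B : idomainType) (iota : k -> B) (p : {poly B}) :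
  injective iota -> p != 0 -> exists x, p.[iota x] != 0.
Proof.
move=> inj nzp; have [rs urs szrs] := infinite_uniq (size p).
have [alr|] := boolP (all (root p) (map iota rs)).
  have := max_poly_roots nzp alr; rewrite map_inj_uniq // size_map szrs => /(_ urs).
  by rewrite ltnn.
by case/allPn=> _ /mapP[x _ ->] nr; exists x.
Qed.

Local Notation K := {fraction {poly k}}.

Definition genconst : k -> K := @tofrac {poly k} \o polyC.
HB.instance Definition _ := GRing.RMorphism.copy genconst (@tofrac {poly k} \o polyC).

Definition genpar : K := tofrac 'X.

(** A nonzero maximal minor is the image of a polynomial in s, which has a
    non-root in k. *)
Lemma specialize_rank m n (A B : 'M[k]_(m, n)) : exists c : k,
  (\rank (map_mx genconst A - genpar *: map_mx genconst B)%R <= \rank (A - c *: B)%R)%N.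
Proof.
set M := (map_mx genconst A - _); pose P : 'M[{poly k}]_(m, n) :=
  map_mx polyC A - 'X *: map_mx polyC B.
have [f [g nz]] := maxminor M.
have MP : mxsub f g M = map_mx (@tofrac {poly k}) (mxsub f g P).
  by apply/matrixP=> i j; rewrite !mxE rmorphB rmorphM.
have nzp : \det (mxsub f g P) != 0.
  by apply: contraNneq nz => P0; rewrite MP det_map_mx P0 rmorph0.
have [c nzc] := nonroot (iota := id) (fun x y => id) nzp.
exists c; apply: (@minor_rank _ _ _ _ _ f g).
move: nzc; rewrite -[_.[_]]/(horner_eval c _) -det_map_mx map_mxsub.
congr (\det (mxsub _ _ _) != 0); apply/matrixP=> i j.
by rewrite !mxE /= /horner_eval !hornerE.
Qed.

End Specialize.

(** * Catalecticant ranks on a plateau *)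
Section Core.
Variable k : fieldType.
Implicit Types (mu : 'X_{1..3} -> k).
Local Notation K := {fraction {poly k}}.
Local Notation S := {mpoly k[3]}.
Local Notation lift := (map_poly (@tofrac {poly k})).
Local Notation ann a b mu := (ann_line (genpar k) (genconst a) (genconst b) (@genconst k \o mu)).

Lemma tofrac_dehomog a b (g : S) : lift (dehomog a b g) =
  to_line idfun (genpar k) (genconst a) (genconst b) (map_mpoly (@genconst k) g).
Proof. by rewrite /dehomog map_to_line to_line_map; apply: eq_mmap. Qed.

Lemma ann_line_dehomog a b mu n i e (u : 'rV[k]_(nmons i)) : (i < n)%N ->
  u *m catal mu i e = 0 -> rows_in (ann a b mu n i e) (lift (dehomog a b (form_of u))).
Proof.
move=> lt_in u0; apply/ann_lineP => //; exists (map_mpoly (@genconst k) (form_of u)).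
split; last exact: tofrac_dehomog.
  by rewrite map_form_of form_of_homog.
rewrite map_form_of; apply/catal_kerP.
by rewrite -map_catal -map_mxM u0 map_mx0.
Qed.

Lemma ann_line_neq0 a b mu n i e : (i < n)%N ->
  (\rank (catal mu i e) < nmons i)%N -> ann a b mu n i e != 0.
Proof.
move=> lt_in lt; have : kermx (catal mu i e) != 0.
  by rewrite -mxrank_eq0 mxrank_ker -lt0n subn_gt0.
case/rowV0Pn=> u /sub_kermxP u0 nzu; apply: contraNneq nzu => W0.
have /andP[sz /submxP[D r0]] := ann_line_dehomog a b lt_in u0.
rewrite W0 mulmx0 in r0.
have l0 : lift (dehomog a b (form_of u)) = 0 by rewrite -(poly_rV_K sz) r0 linear0.
have /(dehomog_inj (form_of_homog u)) f0 : dehomog a b (form_of u) = 0.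
  by apply: map_tofrac_inj; rewrite l0 rmorph0.
by rewrite -[u]form_ofK f0 linear0.
Qed.

Lemma rank_catal_genconst mu i e :
  \rank (catal (@genconst k \o mu) i e) = \rank (catal mu i e).
Proof. by rewrite -map_catal mxrank_map. Qed.

(** The identity h_i - h_(i-1) = c_i - c_(d+1-i) of the introduction, with
    i + 1 in place of i: rank_ann_line is used in degrees (i, e) and (e, i),
    where its right-hand terms have the same rank. If no form of degree i + 1 is
    annihilated, the rank is the number of monomials and the bound is clear. *)
Lemma catal_unimodal mu i e : (i <= e)%N ->
  (\rank (catal mu i e.+1) <= \rank (catal mu i.+1 e))%N.
Proof.
move=> le_ie; have [full|lt] := leqP (nmons i.+1) (\rank (catal mu i.+1 e)).
  apply: leq_trans (rank_leq_row _) (leq_trans _ full).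
  by rewrite nmons_succ leq_addr.
pose n := (e.+3)%N.
have nz : ann 0 0 mu n i.+1 e != 0 by apply: ann_line_neq0 => //; rewrite /n; lia.
have h1 := @rank_ann_line _ (genpar k) (genconst 0) (genconst 0)
   (@genconst k \o mu) n i e ltac:(rewrite /n; lia).
have h2 := @rank_ann_line _ (genpar k) (genconst 0) (genconst 0)
   (@genconst k \o mu) n e i ltac:(rewrite /n; lia).
have : (\rank (ann 0 0 mu n i.+1 e) + (e - i) <= \rank (ann 0 0 mu n e.+1 i))%N.
  have := @ann_line_add _ (genpar k) (genconst 0) (genconst 0)
   (@genconst k \o mu) n i.+1 i (e - i).
  rewrite addSn subnKC //; apply=> //; rewrite /n; lia.
rewrite rank_catalC [in RHS]rank_catalC in h2.
rewrite !rank_catal_genconst in h1 h2.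
move: h1 h2 => h1 h2 h3; lia.
Qed.

(** If all annihilated forms of degree f + j are multiples of G, they correspond
    to the forms of degree j annihilated by the contracted functional. One
    degree lower, the multiples of G still give a lower bound on the
    annihilated forms. Passing from degree f + j - 1 to f + j the number of
    monomials grows by f more than from j - 1 to j, and the contracted
    functional has nondecreasing rank there. *)
Lemma factor_growth mu (G : S) f j e : G \is f.-homog -> G != 0 -> (0 < f)%N ->
  (f + j <= e.+1)%N ->
  (forall u : 'rV_(nmons (f + j)), u *m catal mu (f + j) e = 0 ->
     exists2 h, h \is j.-homog & form_of u = G * h) ->
  (\rank (catal mu (f + j).-1 e.+1) < \rank (catal mu (f + j) e))%N.
Proof.
move=> hG nzG f_gt0 le_e div.
have up : (nmons (f + j) - \rank (catal mu (f + j) e) <=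
           nmons j - \rank (catal (contract mu G) j e))%N.
  rewrite -!mxrank_ker; apply: leq_trans (mxrankM_maxl _ (mulform G j (f + j))).
  apply: mxrankS; apply/row_subP=> p.
  have u0 : row p (kermx (catal mu (f + j) e)) *m catal mu (f + j) e = 0.
    by apply/sub_kermxP; rewrite row_sub.
  have [h hh uE] := div _ u0.
  rewrite -[row p _]form_ofK uE -(coordsK hh) -mul_mulform; apply: submxMr.
  apply/sub_kermxP; rewrite -(mulform_catal hG erefl) mulmxA.
  by rewrite mul_mulform coordsK // -uE form_ofK.
have r1 := rank_leq_row (catal mu (f + j) e).
have r2 := rank_leq_row (catal (contract mu G) j e).
case: f hG f_gt0 le_e div up r1 => // f hG _ le_e _ up r1; rewrite addSn /= in le_e up r1 *.
have n1 := nmons_succ (f + j).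
case: j le_e up r1 r2 n1 => [|j] le_e up r1 r2 n1.
  by have := rank_leq_row (catal mu (f + 0) e.+1); move: nmons0; lia.
have down : (nmons j - \rank (catal (contract mu G) j e.+1) <=
           nmons (f + j.+1) - \rank (catal mu (f + j.+1) e.+1))%N.
  rewrite -!mxrank_ker.
  have fr : row_free (mulform G j (f + j.+1)).
    by apply: (mulform_free hG) => //; rewrite addnS.
  rewrite -(mxrankMfree _ fr); apply: mxrankS; apply/sub_kermxP.
  by rewrite -mulmxA (mulform_catal hG) ?addnS // mulmx_ker.
have r3 := rank_leq_row (catal (contract mu G) j e.+1).
have r4 := rank_leq_row (catal mu (f + j.+1) e.+1).
have := @catal_unimodal (contract mu G) j e ltac:(lia).
have := nmons_succ j; lia.
Qed.

Hypothesis infk : infinite_field k.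

(** A point of the chart z = 1 where g does not vanish. The polynomial
    dehomog 0 0 g is g(s, 1, Z); a nonzero value at (x, c) with c nonzero is
    rescaled to the point (x/c, 1/c, 1). *)
Lemma good_point (g : S) i : g \is i.-homog -> g != 0 ->
  exists a b : k, (dehomog a b g)`_i != 0.
Proof.
move=> hg nzg.
(* The factor 'X forces the second coordinate c to be nonzero. *)
have nzP : dehomog 0 0 g * 'X != 0.
  rewrite mulf_neq0 ?polyX_eq0 //.
  by apply: contra_neq nzg; apply: (dehomog_inj hg).
have [c nzc] := nonroot infk (@polyC_inj k) nzP.
rewrite hornerM hornerX mulf_eq0 negb_or polyC_eq0 in nzc.
case/andP: nzc => nzgc nzc.
have [x nzx] := nonroot infk (iota := id) (fun x y => id) nzgc.
exists (x / c), c^-1; rewrite /dehomog (to_line_top _ _ _ _ hg).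
pose h (j : 'I_3) : k := nth 0 [:: x / c; c^-1; 1] j.
rewrite (@eq_mmap _ _ _ (polyC \o idfun) _ (polyC \o h)) //; last first.
  by elim/ord3P.
rewrite -(rmorph_mmap polyC idfun) polyC_eq0.
apply: contraNneq nzx => h0.
have -> : (dehomog 0 0 g).[c%:P].[x] = mmap idfun (fun j => c * h j) g.
  rewrite -[LHS]/((horner_eval x \o horner_eval c%:P) (to_line polyC 'X 0%:P 0%:P g)).
  rewrite /to_line rmorph_mmap; apply: eq_mmap => [d|j] /=.
    by rewrite /horner_eval !hornerC.
  elim/ord3P: j; rewrite /line_pt /horner_eval /h /= !hornerE.
  - by rewrite -[RHS]/(c * x * c^-1) mulrAC divff // mul1r.
  - by rewrite divff.
  - by [].
by rewrite (mmap_scale _ _ _ hg) h0 mulr0.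
Qed.

Lemma contract_generic_line mu a b i e :
  catal (contract (@genconst k \o mu) (pencil_line (genpar k) (genconst a) (genconst b))) i e =
  map_mx (@genconst k) (catal (contract mu (pencil0 a)) i e) -
  genpar k *: map_mx (@genconst k) (catal (contract mu (pencil1 b)) i e).
Proof.
apply/matrixP=> p q; rewrite !mxE /contract /pencil_line -!ev_map.
rewrite mulrBl linearB -scalerAl linearZ /=; congr (ev _ _ - _ * ev _ _).
  by rewrite rmorphM rmorphB /= map_mpolyZ !map_mpolyX.
by rewrite rmorphM rmorphB /= map_mpolyZ !map_mpolyX.
Qed.

Lemma contract_pencil_line mu c a b i e :
  catal (contract mu (pencil_line c a b)) i e =
  catal (contract mu (pencil0 a)) i e - c *: catal (contract mu (pencil1 b)) i e.
Proof.
apply/matrixP=> p q; rewrite !mxE /contract /pencil_line.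
by rewrite mulrBl linearB -scalerAl linearZ.
Qed.

(** In terms of the algebra of the functional, of socle degree i + 1 + e, the
    form l maps degree i onto degree i + 1. *)
Lemma plateau_bijective mu i e : (i < e)%N ->
  \rank (catal mu i e.+1) = \rank (catal mu i.+1 e) ->
  exists l : S, l \is 1.-homog /\
    (\rank (catal mu i.+1 e) <= \rank (catal (contract mu l) i e))%N.
Proof.
move=> lt_ie eqr.
have lt_r : (\rank (catal mu i.+1 e) < nmons i.+1)%N.
  by rewrite -eqr (leq_ltn_trans (rank_leq_row _)) // nmons_succ; lia.
have [u0 u0k nzu0] : exists2 u : 'rV_(nmons i.+1), u *m catal mu i.+1 e = 0 & u != 0.
  have : kermx (catal mu i.+1 e) != 0.
    by rewrite -mxrank_eq0 mxrank_ker -lt0n subn_gt0.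
  by case/rowV0Pn=> u /sub_kermxP uk nzu; exists u.
have nzg : form_of u0 != 0.
  by apply: contraNneq nzu0 => g0; rewrite -[u0]form_ofK g0 linear0.
have [a [b top]] := good_point (form_of_homog u0) nzg.
case: e lt_ie eqr lt_r u0k => // e lt_ie eqr lt_r u0k.
(* Room for the polynomials of size e + 3 that occur in degree e + 2. *)
pose n := (e.+4)%N; pose muK := @genconst k \o mu.
pose J i e := ann a b mu n i e.
have h1 := @rank_ann_line _ (genpar k) (genconst a) (genconst b) muK n i e.+1 ltac:(lia).
have h2 := @rank_ann_line _ (genpar k) (genconst a) (genconst b) muK n e.+1 i ltac:(lia).
rewrite rank_catalC [in RHS]rank_catalC in h2.
rewrite !rank_catal_genconst in h1 h2.
rewrite -/(J i.+1 e.+1) in h1; rewrite -/(J e.+2 i) in h2.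
have [lt_dim|ge_dim] := ltnP (\rank (J i.+1 e.+1)) i.+2; last first.
  have [c] := specialize_rank infk (catal (contract mu (pencil0 a)) i e.+1)
    (catal (contract mu (pencil1 b)) i e.+1).
  rewrite -contract_generic_line -contract_pencil_line => le.
  exists (pencil_line c a b); split; first exact: pencil_line_homog.
  by apply: leq_trans le; rewrite -/muK; lia.
have nzJ : J i.+1 e.+1 != 0 by apply: ann_line_neq0 => //; lia.
have lt1 : (\rank (J i.+1 e.+1) < \rank (J i.+2 e))%N.
  by apply: ann_line_lt nzJ; lia.
have le2 : (\rank (J i.+2 e) + (e - i) <= \rank (J e.+2 i))%N.
  have := @ann_line_add _ (genpar k) (genconst a) (genconst b) muK n i.+2 i (e - i).
  have eE : (i + (e - i) = e)%N by lia.
  rewrite !addSn eE; apply; first by lia.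
  by rewrite -/(J _ _) -mxrank_eq0; lia.
(* lt1 and le2 bound the growth from degree i + 1 to degree e + 2 from below;
   h1, h2 and eqr say that this bound is attained, so it is attained at each
   step. *)
have rk1 : \rank (J i.+2 e) = (\rank (J i.+1 e.+1)).+1 by lia.
pose f0 := lift (dehomog a b (form_of u0)).
have Jf0 : rows_in (J i.+1 e.+1) f0 by apply: ann_line_dehomog => //; lia.
have szf0 : size f0 = i.+2.
  apply/eqP; rewrite eqn_leq; apply/andP; split.
    by apply: size_ann_line Jf0; lia.
  rewrite ltnNge; apply/negP => /leq_sizeP/(_ _ (leqnn _))/eqP.
  by rewrite coef_map /= tofrac_eq0 (negbTE top).
have lt_n : (i.+2 < n)%N by lia.
have [G szG dvdG] := @window_gcd K n _ _ i.+1 (J i.+1 e.+1) (J i.+2 e) lt_n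
  (fun f => @size_ann_line _ _ _ _ _ n i.+1 e.+1 f (ltnW lt_n))
  (ann_line_sub _ _ _ _ _ lt_n)
  (fun f => @ann_lineX _ _ _ _ _ n i.+1 e f lt_n)
  rk1 lt_dim f0 Jf0 szf0.
have [F szF dvdF] := gauss_factor szG.
have nzF : F != 0 by rewrite -size_poly_gt0 ltnW.
have [f [Gh hGh [GhF hom]]] := dehomog_factor a b nzF.
have f_gt0 : (0 < f)%N.
  have := size_to_line polyC 'X a%:P b%:P hGh; rewrite -/(dehomog a b Gh) GhF.
  by rewrite lt0n; apply: contraTneq => ->; rewrite -ltnNge.
have nzGh : Gh != 0.
  by apply: contraNneq nzF => G0; rewrite -GhF G0 rmorph0.
have divk u : u *m catal mu i.+1 e.+1 = 0 -> form_of u != 0 ->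
    exists2 j, i.+1 = (f + j)%N & exists2 h, h \is j.-homog & form_of u = Gh * h.
  move=> uk nzu; apply: hom => //; first exact: form_of_homog.
  exact/dvdF/dvdG/(ann_line_dehomog _ _ (ltnW lt_n) uk).
have [j ij _] := divk u0 u0k nzg.
have := @factor_growth mu Gh f j e.+1 hGh nzGh f_gt0.
rewrite -ij /= eqr ltnn => /(_ (leqW lt_ie)) contr.
suff /contr : forall u : 'rV_(nmons i.+1), u *m catal mu i.+1 e.+1 = 0 ->
  exists2 h, h \is j.-homog & form_of u = Gh * h by [].
move=> u uk; have [u_eq0|nzu] := eqVneq (form_of u) 0.
  by exists 0; rewrite ?rpred0 // mulr0.
have [j' ij' [h hh uE]] := divk u uk nzu.
have -> : j = j' by apply: (@addnI f); rewrite -ij -ij'.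
by exists h.
Qed.

End Core.

(** * Peaks of an h-vector *)
Section Peaks.
Variable h : seq nat.
Hypothesis h_gt0 : (0 < size h)%N.

Lemma hmax_mem : hmax h \in h.
Proof.
case: h h_gt0 => // x s _; rewrite /hmax.
elim: s x => [|y s IH] x; first by rewrite big_seq1 inE.
rewrite big_cons; case: leqP => _; last by rewrite mem_head.
by rewrite in_cons IH orbT.
Qed.

Lemma nth_le_hmax i : (i < size h)%N -> (nth 0%N h i <= hmax h)%N.
Proof. by move=> lt; apply: leq_bigmax_seq => //; apply: mem_nth. Qed.

Lemma first_peakP : (first_peak h < size h)%N /\ nth 0%N h (first_peak h) = hmax h.
Proof. by rewrite index_mem nth_index hmax_mem. Qed.

Lemma first_peak_le i : nth 0%N h i = hmax h -> (first_peak h <= i)%N.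
Proof.
move=> hi; rewrite leqNgt; apply/negP => /(before_find 0%N) /=.
by rewrite hi eqxx.
Qed.

Lemma last_peakP : (last_peak h < size h)%N /\ nth 0%N h (last_peak h) = hmax h.
Proof.
have [lt e] := first_peakP.
have [|i /eqP hi maxE] := @eq_bigmax_cond _ [pred i : 'I_(size h) | nth 0%N h i == hmax h] val.
  by apply/card_gt0P; exists (Ordinal lt); rewrite inE /= e.
have -> : last_peak h = i by rewrite /last_peak -[RHS]maxE; apply: eq_bigl.
by rewrite ltn_ord.
Qed.

End Peaks.

(** * Macaulay duality and the Lefschetz property *)
Lemma homogXM (k : fieldType) t i (g : {mpoly k[3]}) :
  g \is i.-homog -> 'X_t * g \is i.+1.-homog.
Proof. by move=> hg; have := dhomogM (homogXi k t) hg; rewrite add1n. Qed.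

Section Algebra.
Variables (k : fieldType) (I : idealr {mpoly k[3]}).
Local Notation S := {mpoly k[3]}.
Local Notation R := {ideal_quot I}.
Hypothesis homogI : homogeneous_ideal I.

Lemma pi_eq0 (f : S) : (\pi_R f == 0) = (f \in I).
Proof. by rewrite -[f in RHS]subr0 Quotient.idealrBE eqE /= raddf0. Qed.

Lemma ideal_mul (f g : S) : g \in I -> f * g \in I.
Proof. exact: idealMr. Qed.

Lemma ideal_scale c (g : S) : g \in I -> c *: g \in I.
Proof. by rewrite -mul_mpolyC; exact: idealMr. Qed.

Lemma ideal_homog_split i j (f g : S) : i != j -> f \is i.-homog -> g \is j.-homog ->
  f - g \in I -> f \in I.
Proof.
move=> nij hf hg /homogI/(_ i).
by rewrite pihomogB (pihomog_dE hf) (pihomog_ne0 _ hg) ?subr0 // eq_sym.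
Qed.

Hypothesis gorI : gorenstein I.
Variable d : nat.
Hypothesis socd : socle_degree I d.

Lemma above_socle i (f : S) : (d < i)%N -> f \is i.-homog -> f \in I.
Proof.
move=> lt hf; have [_ above] := socd.
by rewrite -pi_eq0; apply/eqP; apply: above lt _; exists f.
Qed.

Lemma socle_vars (g : S) : (forall t, 'X_t * g \in I) -> socle (\pi_R g).
Proof.
move=> Xg f [c ->]; apply/eqP; rewrite -rmorphM /= pi_eq0 mulr_suml.
by apply: rpred_sum => t _; rewrite -mulrA ideal_mul.
Qed.

(** The socle is a line and contains R_d, so any nonzero element of R_d spans
    it. *)
Lemma socle_gen : exists fd : S, [/\ fd \is d.-homog, fd \notin I &
  forall g, (forall t, 'X_t * g \in I) -> exists c, g - c *: fd \in I].
Proof.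
have [[a [fd hfd ->] nz] _] := socd.
have nI : fd \notin I by rewrite -pi_eq0; apply/eqP.
exists fd; split=> // g Xg.
have [b [_ _ sp]] := gorI.
have [c gE] := sp _ (socle_vars Xg).
have [c' fE] : exists c' : 'I_1 -> k, \pi_R fd = \sum_i c' i *: b i.
  apply: sp; apply: socle_vars => t; apply: (@above_socle d.+1) => //.
  exact: homogXM.
rewrite !big_ord1 in gE fE.
have nzc' : c' ord0 != 0.
  by apply: contra_not_neq nz => c0; rewrite fE c0 scale0r.
exists (c ord0 / c' ord0); rewrite -pi_eq0 rmorphB /= pi_scale gE fE scalerA.
by rewrite divfK // subrr.
Qed.

Lemma socle_low i (g : S) : (i < d)%N -> g \is i.-homog ->
  (forall t, 'X_t * g \in I) -> g \in I.
Proof.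
move=> lt hg Xg; have [fd [hfd _ /(_ _ Xg)[c gc]]] := socle_gen.
have hcf : c *: fd \is d.-homog by apply: rpredZ.
by apply: ideal_homog_split hg hcf gc; rewrite ltn_eqF.
Qed.

(** The functional reads off the coordinate on the line R_d. *)
Lemma dual_functional : exists mu : 'X_{1..3} -> k,
  forall f, f \is d.-homog -> (f \in I) = (ev mu f == 0).
Proof.
have [fd [hfd nI gen]] := socle_gen.
have ex m : exists c, pihomog mdeg d ('X_[m] : S) - c *: fd \in I.
  apply: gen => t; apply: (@above_socle d.+1) => //.
  exact/homogXM/pihomogP.
pose mu m := xchoose (ex m).
exists mu => f hf; have fmu : f - ev mu f *: fd \in I.
  have {1}-> : f = \sum_(m <- msupp f) f@_m *: pihomog mdeg d 'X_[m].
    rewrite -{1}(pihomog_dE hf) {1}[f]mpolyE raddf_sum; apply: eq_bigr => m _ /=.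
    by rewrite linearZ.
  rewrite /ev scaler_suml -sumrB; apply: rpred_sum => m _.
  by rewrite -scalerA -scalerBr ideal_scale // (xchooseP (ex m)).
apply/idP/eqP=> [fI|f0]; last by move: fmu; rewrite f0 scale0r subr0.
apply/eqP; apply: contraNT nI => nz.
rewrite -[fd](scalerK nz) ideal_scale //.
have -> : ev mu f *: fd = f - (f - ev mu f *: fd) by rewrite opprB addrC subrK.
exact: rpredB.
Qed.

Variable mu : 'X_{1..3} -> k.
Hypothesis muP : forall f, f \is d.-homog -> (f \in I) = (ev mu f == 0).

(** A form orthogonal to S_(e+1) has all its products with variables
    orthogonal to S_e; by induction these lie in I, so the form is in the socle,
    which vanishes below degree d. *)
Lemma pairing i e (g : S) : (i + e = d)%N -> g \is i.-homog ->
  g \in I <-> (forall h, h \is e.-homog -> ev mu (g * h) = 0).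
Proof.
move=> ied hg; split=> [gI h hh|].
  have ghd : g * h \is d.-homog by rewrite -ied; apply: dhomogM.
  by apply/eqP; rewrite -muP // mulrC; apply: ideal_mul.
elim: e i g ied hg => [|e IH] i g ied hg g0.
  rewrite muP; first by rewrite -[g]mulr1 g0 ?dhomog1.
  by rewrite -ied addn0.
apply: (socle_low _ hg); first by lia.
move=> t; apply: (IH i.+1); first by lia.
  exact: homogXM.
move=> h hh; rewrite [_ * g]mulrC -mulrA; apply: g0.
exact: homogXM.
Qed.

Lemma pairing_ker i e (u : 'rV_(nmons i)) : (i + e = d)%N ->
  (u *m catal mu i e == 0) = (form_of u \in I).
Proof.
move=> ied; have P := pairing ied (form_of_homog u).
by apply/idP/idP => [/catal_kerP/P | /P/catal_kerP].
Qed.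

(** The kernel of the catalecticant matrix M is I_i. If the rows of B are
    representatives of a basis of R_i, then B M is row free because the basis is
    independent, and has the row space of M because the basis spans. *)
Lemma dim_rank i e n : (i + e = d)%N -> has_dim (@graded_part k 3 I i) n ->
  n = \rank (catal mu i e).
Proof.
move=> ied [b [bgr indep sp]].
have [B0 bB0] : exists B0 : 'I_n -> 'rV[k]_(nmons i), forall q, b q = \pi_R (form_of (B0 q)).
  apply: (fin_all_exists (P := fun q u => b q = \pi_R (form_of u))) => q.
  by have [f hf ->] := bgr q; exists (coords i f); rewrite coordsK.
pose B := \matrix_q B0 q.
have piB (v : 'rV_n) : \pi_R (form_of (v *m B)) = \sum_q v 0 q *: b q.
  rewrite mulmx_sum_row linear_sum raddf_sum; apply: eq_bigr => q _ /=.
  by rewrite linearZ pi_scale rowK bB0.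
set M := catal mu i e.
have fr : row_free (B *m M).
  rewrite -kermx_eq0; apply/eqP/row_matrixP=> q; rewrite row0.
  set v := row q _; have : v *m (B *m M) = 0 by apply/sub_kermxP; rewrite row_sub.
  rewrite mulmxA => /eqP; rewrite pairing_ker // -pi_eq0 piB => /eqP /indep v0.
  by apply/rowP=> t; rewrite v0 mxE.
have /eqP <- := fr; apply/eqP; rewrite eqn_leq mxrankM_maxr andTb.
apply: mxrankS; apply/row_subP=> p; rewrite rowE.
set u := delta_mx 0 p.
have [c cE] : exists c : 'I_n -> k, \pi_R (form_of u) = \sum_q c q *: b q.
  by apply: sp; exists (form_of u) => //; exact: form_of_homog.
have : (u - (\row_q c q) *m B) *m M == 0.
  rewrite pairing_ker // linearB -pi_eq0 raddfB /= piB cE subr_eq0.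
  by apply/eqP; apply: eq_bigr => q _; rewrite mxE.
rewrite mulmxBl subr_eq0 => /eqP ->.
by rewrite -mulmxA submxMl.
Qed.

Section Lefschetz.
Variables (l : S) (t e : nat).
Hypotheses (hl : l \is 1.-homog) (ted : (t + e.+1 = d)%N)
  (flat : \rank (catal mu t e.+1) = \rank (catal mu t.+1 e))
  (rkl : (\rank (catal mu t.+1 e) <= \rank (catal (contract mu l) t e))%N).

Let X := mulform l t t.+1.
Let XM : X *m catal mu t.+1 e = catal (contract mu l) t e.
Proof. exact: mulform_catal hl (add1n _) _ _. Qed.

Let ted1 : (t.+1 + e = d)%N. Proof. by rewrite -ted addnS. Qed.

(** The kernel of the pairing contracted by l contains I_t and, by the rank
    hypotheses, is no larger. *)
Lemma inj_plateau (g : S) : g \is t.-homog -> l * g \in I -> g \in I.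
Proof.
move=> hg lgI; have sub : (kermx (catal mu t e.+1) <= kermx (catal (contract mu l) t e))%MS.
  apply/row_subP=> p; apply/sub_kermxP/eqP.
  rewrite -XM mulmxA pairing_ker // (form_mulform hl) //; apply: ideal_mul.
  by rewrite -(pairing_ker _ ted); apply/eqP/sub_kermxP; rewrite row_sub.
have bus : (kermx (catal (contract mu l) t e) <= kermx (catal mu t e.+1))%MS.
  by rewrite -mxrank_leqif_sup // eqn_leq mxrankS // !mxrank_ker leq_sub2l // flat.
rewrite -(coordsK hg) -(pairing_ker _ ted); apply/eqP/sub_kermxP.
apply: submx_trans bus; apply/sub_kermxP/eqP.
by rewrite -XM mulmxA pairing_ker // (form_mulform hl) // coordsK.
Qed.

Lemma surj_plateau (g : S) : g \is t.+1.-homog ->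
  exists2 h : S, h \is t.-homog & g - l * h \in I.
Proof.
move=> hg; have sub : (catal mu t.+1 e <= X *m catal mu t.+1 e)%MS.
  by rewrite -mxrank_leqif_sup ?submxMl // eqn_leq mxrankM_maxr XM.
have /submxP[v vE] := submx_trans (submxMl (coords t.+1 g) _) sub.
exists (form_of v); first exact: form_of_homog.
rewrite -(form_mulform hl (add1n _)) -(coordsK hg) -linearB -(pairing_ker _ ted1).
by rewrite mulmxBl vE mulmxA subrr.
Qed.

(** If l g is zero in R, so is l (x g) for every variable x; one degree up this
    puts x g in I, and then g is in the socle. *)
Lemma inj_below i (g : S) : (i <= t)%N -> g \is i.-homog -> l * g \in I -> g \in I.
Proof.
move=> le; have [s] := ubnP (t - i)%N; elim: s i g le => // s IH i g le lt hg lgI.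
move: le; rewrite leq_eqVlt => /orP[/eqP it|lt_it].
  by apply: inj_plateau => //; rewrite -it.
apply: (socle_low _ hg); first by lia.
move=> x; apply: (IH i.+1) => //; first by lia.
  exact: homogXM.
by rewrite mulrCA ideal_mul.
Qed.

(** Every monomial of positive degree is a variable times a monomial of one
    degree less. *)
Lemma surj_above i (g : S) : (t <= i)%N -> g \is i.+1.-homog ->
  exists2 h : S, h \is i.-homog & g - l * h \in I.
Proof.
move=> le; have -> : i = (t + (i - t))%N by lia.
elim: (i - t)%N g => {i le} [|s IH] g; first by rewrite addn0; exact: surj_plateau.
rewrite addnS => hg; pose Q g := exists2 h : S, h \is (t + s).+1.-homog & g - l * h \in I.
rewrite -/(Q g) -(coordsK hg) /form_of; apply: (big_ind Q) => [|f1 f2|p _].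
- by exists 0; rewrite ?rpred0 // mulr0 subrr rpred0.
- case=> h1 hh1 I1 [h2 hh2 I2]; exists (h1 + h2); first exact: rpredD.
  by rewrite mulrDr opprD addrACA rpredD.
have [x mx] : exists x : 'I_3, (0 < mon p x)%N.
  apply/existsP; rewrite -[X in is_true X]negbK negb_exists; apply/negP => /forallP m0.
  have := mdeg_mon p; rewrite mdegE big1 // => x _.
  by apply/eqP; rewrite -leqn0 leqNgt.
have [h hh hI] : Q ('X_[mon p]).
  have mE : mon p = (U_(x) + (mon p - U_(x)))%MM.
    by rewrite addmC submK // lep1mP -lt0n.
  have [|h hh hI] := IH 'X_[mon p - U_(x)].
    rewrite dhomogX; apply/eqP; have := mdeg_mon p; rewrite {1}mE mdegD mdeg1 add1n.
    by case.
  exists ('X_x * h); first exact: homogXM.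
  by rewrite mE mpolyXD mulrCA -mulrBr ideal_mul.
exists ((coords (t + s).+2 g) 0 p *: h); first exact: rpredZ.
by rewrite -scalerAr -scalerBr ideal_scale.
Qed.

Lemma lefschetz_of_plateau : weak_lefschetz I.
Proof.
exists (\pi_R l); first by exists l.
move=> i; have [le|lt] := leqP i t; [left|right].
  move=> _ _ [f hf ->] [g hg ->]; rewrite -!rmorphM /= => /eqP.
  rewrite -subr_eq0 -rmorphB /= pi_eq0 -mulrBr => lfg.
  apply/eqP; rewrite -subr_eq0 -rmorphB /= pi_eq0.
  by apply: (inj_below le) lfg; exact: rpredB.
move=> _ [g hg ->]; have [h hh ghI] := surj_above (ltnW lt) hg.
exists (\pi_R h); first by exists h.
by apply/eqP; rewrite -rmorphM eq_sym -subr_eq0 -rmorphB /= pi_eq0.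
Qed.

End Lefschetz.
End Algebra.

Theorem theorem5p5 (k : fieldType) (infinite_k : infinite_field k)
    (I : idealr {mpoly k[3]}) (homogI : homogeneous_ideal I)
    (artinianR : artinian I) (gorensteinR : gorenstein I)
    (h : seq nat) (hvectorR : is_hvector I h)
    (codim3 : nth 0%N h 1 = 3%N) (peaks3 : (3 <= num_peaks h)%N) :
  weak_lefschetz I.
Proof.
have [d [socd szh dimh]] := hvectorR.
have [mu muP] := dual_functional gorensteinR socd.
have hE i : (i <= d)%N -> nth 0%N h i = \rank (catal mu i (d - i)).
  by move=> le; apply: (dim_rank homogI gorensteinR socd muP (subnKC le) (dimh i le)).
have h_gt0 : (0 < size h)%N by rewrite szh.
have [ltt ht] := first_peakP h_gt0; have [ltL hL] := last_peakP h_gt0.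
(* By symmetry the degree d - last_peak h is a peak too. *)
have leL : (first_peak h <= d - last_peak h)%N.
  apply: first_peak_le; rewrite -hL !hE ?leq_subr //; try by lia.
  by rewrite rank_catalC subKn //; lia.
move: peaks3; rewrite /num_peaks => ge3.
set t := first_peak h in ltt ht leL ge3.
pose e := (d - t).-1.
have et : (d - t = e.+1)%N by rewrite /e; lia.
have lt_te : (t < e)%N by lia.
have flat : \rank (catal mu t e.+1) = \rank (catal mu t.+1 e).
  apply/eqP; rewrite eqn_leq catal_unimodal ?(ltnW lt_te) //=.
  have := @nth_le_hmax h t.+1 ltac:(lia).
  rewrite -ht !hE; try by lia.
  by rewrite et (_ : d - t.+1 = e)%N //; lia.
have [l [hl rkl]] := plateau_bijective infinite_k lt_te flat.
apply: (lefschetz_of_plateau homogI gorensteinR socd muP hl _ flat rkl); lia.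
Qed.
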